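(* Let $\{\omega_x\}_{x\in\mathbb Z^2}$ be independent rate $1$ exponentially distributed random variables. Then for each $\xi=(\xi_1,\xi_2)\in\mathbb R_{\ge0}^2$, with probability $1$, $$\lim_{N\to\infty}N^{-1}G_{0,\lfloor N\xi\rfloor}=g_{\rm pp}(\xi)\equiv\bigl(\sqrt{\xi_1}+\sqrt{\xi_2}\,\bigr)^2 .$$
   Context: For $x\le y$ (coordinatewise) in $\mathbb Z^2$, $G_{x,y}=\max\sum_{k=0}^{|y-x|_1}\omega_{x_k}$, the maximum being over up-right lattice paths $(x_k)_{k=0}^{|y-x|_1}$ from $x_0=x$ to $y$ with increments $x_{k+1}-x_k\in\{e_1,e_2\}=\{(1,0),(0,1)\}$. Integer parts are coordinatewise: $\lfloor\xi\rfloor=(\lfloor\xi_1\rfloor,\lfloor\xi_2\rfloor)$. *)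

(* Defs.v *)
From HB Require Import structures.
From mathcomp Require Import all_boot all_order all_algebra.
From mathcomp Require Import all_classical all_reals all_analysis.
Set Implicit Arguments.
Unset Strict Implicit.
Unset Printing Implicit Defensive.
Import Order.TTheory GRing.Theory Num.Theory.
Import numFieldNormedType.Exports.
Local Open Scope classical_set_scope.
Local Open Scope ring_scope.

Definition mutually_independent d (T : measurableType d) (R : realType)
    (P : probability T R) (I : choiceType) (X : I -> {RV P >-> R}) : Prop :=
  forall (s : seq I) (A : I -> set R), uniq s ->
    (forall i, i \in s -> measurable (A i)) ->
    P (\bigcap_(i in [set` s]) (X i @^-1` A i)) =
      (\prod_(i <- s) P (X i @^-1` A i))%E.

Definition exponentially_distributed d (T : measurableType d) (R : realType)
    (P : probability T R) (rate : R) (X : {RV P >-> R}) : Prop :=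
  forall A : set R, measurable A -> distribution P X A = exponential_prob rate A.

Notation Z2 := (int * int)%type.

Definition e1 : Z2 := (1, 0).
Definition e2 : Z2 := (0, 1).

Definition le_Z2 (x y : Z2) : Prop := x.1 <= y.1 /\ x.2 <= y.2.

Definition l1norm (z : Z2) : nat := (absz z.1 + absz z.2)%N.

Definition floor_pt (R : realType) (xi : R * R) : Z2 :=
  (Num.floor xi.1, Num.floor xi.2).

(* Only the values p 0, ..., p |y - x|_1 matter. *)
Definition up_right_path (x y : Z2) (p : nat -> Z2) : Prop :=
  [/\ p 0%N = x, p (l1norm (y - x)) = y &
      forall k, (k < l1norm (y - x)%R)%N ->
        p k.+1 - p k = e1 \/ p k.+1 - p k = e2].

Definition path_weight (R : realType) (w : Z2 -> R) (x y : Z2)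
    (p : nat -> Z2) : R :=
  \sum_(0 <= k < (l1norm (y - x)).+1) w (p k).

Definition path_weights (R : realType) (w : Z2 -> R) (x y : Z2) : set R :=
  [set path_weight w x y p | p in up_right_path x y].

(* For x <= y the supremum is a maximum: see [passage_time_max]. *)
Definition passage_time (R : realType) (w : Z2 -> R) (x y : Z2) : R :=
  sup (path_weights w x y).

Definition gpp (R : realType) (xi : R * R) : R :=
  (Num.sqrt xi.1 + Num.sqrt xi.2) ^+ 2.

Lemma finite_path_sums (R : realType) (w : Z2 -> R) (x : Z2) (n : nat) (y : Z2) :
  finite_set [set \sum_(0 <= k < n.+1) w (p k) | p in
    [set p : nat -> Z2 | [/\ p 0%N = x, p n = y & forall k, (k < n)%N ->
        p k.+1 - p k = e1 \/ p k.+1 - p k = e2]]].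
Proof.
elim: n y => [|n IH] y.
  apply: (@sub_finite_set _ _ [set w y]); last exact: finite_set1.
  by move=> _ [p [_ py _] <-] /=; rewrite big_nat1 py.
have := conj (IH (y - e1)) (IH (y - e2)).
rewrite -finite_setU => /(finite_image (fun r => r + w y)).
apply: sub_finite_set => _ [p [p0 pn st] <-].
have stn : forall k, (k < n)%N -> p k.+1 - p k = e1 \/ p k.+1 - p k = e2.
  by move=> k kn; apply: st; exact: ltnW.
exists (\sum_(0 <= k < n.+1) w (p k)); last first.
  by rewrite [RHS]big_nat_recr//= pn.
by case: (st n (ltnSn n)); rewrite pn => E; [left|right]; exists p => //;
  split => //; rewrite -E opprB addrC subrK.
Qed.

Lemma finite_set_has_max (R : realType) (A : set R) :
  finite_set A -> A !=set0 -> exists2 m, A m & ubound A m.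
Proof.
move=> /finite_seqP[s ->]; elim: s => [[x]//|a [|b s] IH _].
  by exists a; rewrite /= ?mem_head// => x; rewrite /= inE => /eqP ->.
have [|m sm um] := IH; first by exists b; rewrite /= mem_head.
have [am|/ltW ma] := leP a m.
  exists m; first by rewrite /= in_cons sm orbT.
  by move=> x; rewrite /= in_cons => /predU1P[->//|]; exact: um.
exists a; first by rewrite /= mem_head.
move=> x; rewrite /= in_cons => /predU1P[->//|/um xm].
exact: le_trans xm ma.
Qed.

Lemma up_right_path_exists (x y : Z2) :
  le_Z2 x y -> up_right_path x y !=set0.
Proof.
case: x y => [x1 x2] [y1 y2] [/= h1 h2].
have [a ya] : exists a : nat, y1 = x1 + a%:Z.
  by exists (absz (y1 - x1)); rewrite gez0_abs ?subr_ge0// subrKC.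
have [b yb] : exists b : nat, y2 = x2 + b%:Z.
  by exists (absz (y2 - x2)); rewrite gez0_abs ?subr_ge0// subrKC.
have nab : l1norm ((y1, y2) - (x1, x2))%R = (a + b)%N.
  by rewrite /l1norm /= ya yb ![_ + _ - _]addrAC !subrr !add0r.
rewrite /up_right_path nab.
exists (fun k : nat => (x1 + (minn k a)%:Z, x2 + (k - a)%N%:Z)); split => /=.
- by rewrite min0n sub0n !addr0.
- by rewrite (minn_idPr (leq_addr _ _)) addKn -ya -yb.
- move=> k _ /=; have [ka|ak] := ltnP k a.
    left; have -> : (k.+1 - a = 0)%N by apply/eqP.
    have -> : (k - a = 0)%N by apply/eqP; exact: ltnW.
    rewrite (minn_idPl ka) intS.
    by congr pair; rewrite /= opprD addrACA subrr add0r ?subrr// addrK.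
  right; rewrite (minn_idPr (leqW ak)) subSn// intS.
  by congr pair; rewrite /= opprD addrACA subrr add0r ?subrr// addrK.
Qed.

Lemma passage_time_max (R : realType) (w : Z2 -> R) (x y : Z2) :
  le_Z2 x y ->
  (exists2 p, up_right_path x y p & passage_time w x y = path_weight w x y p) /\
  (forall p, up_right_path x y p -> path_weight w x y p <= passage_time w x y).
Proof.
move=> /up_right_path_exists[p0 p0P].
have [||m [p pP pm] um] := @finite_set_has_max R (path_weights w x y).
- exact: finite_path_sums.
- by exists (path_weight w x y p0); exists p0.
have -> : passage_time w x y = m.
  apply/eqP; rewrite eq_le; apply/andP; split.
    by apply: ge_sup => //; exists m, p.
  by apply: ub_le_sup; [exists m|exists p].
by split; [exists p|move=> q qP; apply: um; exists q].
Qed.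

(* Main.v *)
Require Import Defs.
From HB Require Import structures.
From mathcomp Require Import all_boot all_order all_algebra.
From mathcomp Require Import all_classical all_reals all_analysis.
From mathcomp Require Import measurable_realfun.
From mathcomp Require Import ring lra.
Import Order.TTheory GRing.Theory Num.Theory.
Import numFieldNormedType.Exports.
Local Open Scope classical_set_scope.
Local Open Scope ring_scope.

Set Implicit Arguments.
Unset Strict Implicit.
Unset Printing Implicit Defensive.

(* Glue i.i.d. exponential weights of rates al (along the horizontal axis) and
   be = 1 - al (along the vertical axis) to the rate 1 weights of the quadrant.
   By Burke's theorem the vertical increments of the resulting stationary
   last-passage times L along any column are again i.i.d. of rate be, so L at
   N(x1, x2) is a sum of two sums of i.i.d. exponential variables and
   L / N -> f(al) = x1 / al + x2 / be almost surely, with Chernoff bounds and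
   Borel-Cantelli. Since G <= L, minimizing f gives
   limsup G / N <= (sqrt x1 + sqrt x2)^2.
   For the lower bound take the minimizer al. If the maximizing path of L
   follows the horizontal axis for more than e N steps, replacing al by al - h
   raises its weight by at least N e (1 / (al - h) - 1 / al), which is of order
   h, whereas f changes only at order h^2; for small h this contradicts the law
   of large numbers for the model with parameter al - h, and symmetrically for
   the vertical axis. Hence L exceeds G by at most about N e (1 / al + 1 / be).
   All the models live on the given probability space: their boundary weights
   are multiples of the weights omega at sites with a coordinate equal to -1. *)

(** * Equality of real functions' increments from two-sided bounds *)

Lemma eq0_le_inv (R : realType) (x C : R) :
  0 <= x -> (forall n : nat, x <= C / n.+1%:R) -> x = 0.
Proof.
move=> x0 xC; apply/eqP; rewrite eq_le x0 andbT leNgt; apply/negP => x_gt0.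
have C0 : 0 <= C by move: (le_trans x0 (xC 0%N)); rewrite divr1.
have := archi_boundP (divr_ge0 C0 x0); set m := Num.bound _ => Cm.
have := xC m; rewrite ler_pdivlMr// leNgt => /negP; apply.
rewrite ltr_pdivrMr// in Cm; apply: (lt_le_trans Cm).
by rewrite mulrC ler_wpM2l// ler_nat.
Qed.

(* Over a cell [x, y] of a partition the increments of H and K differ by at most
   L (y - x) (phi x - phi y), and these bounds telescope. *)
Lemma sandwich_eq (R : realType) (H K E phi : R -> R) (a b L : R) : a <= b ->
  (forall x y, a <= x -> x <= y -> y <= b -> 0 <= E y - E x <= L * (y - x)) ->
  (forall x y, a <= x -> x <= y -> y <= b -> phi y <= phi x) ->
  (forall x y, a <= x -> x <= y -> y <= b ->
    (E y - E x) * phi y <= H y - H x <= (E y - E x) * phi x) ->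
  (forall x y, a <= x -> x <= y -> y <= b ->
    (E y - E x) * phi y <= K y - K x <= (E y - E x) * phi x) ->
  H b - H a = K b - K a.
Proof.
move=> ab EL phi_le HP KP.
apply/eqP; rewrite -subr_eq0 -normr_eq0; apply/eqP.
apply: (@eq0_le_inv _ _ (L * (b - a) * (phi a - phi b))) => // n.
pose h := (b - a) / n.+1%:R.
have h0 : 0 <= h by rewrite divr_ge0// subr_ge0.
pose x (k : nat) := a + k%:R * h.
have xn : x n.+1 = b by rewrite /x /h mulrC divfK ?pnatr_eq0// addrC subrK.
have xS k : x k.+1 - x k = h by rewrite /x -natr1; ring.
have ax k : a <= x k by rewrite lerDl mulr_ge0.
have xb k : (k <= n.+1)%N -> x k <= b.
  by move=> kn; rewrite -xn lerD2l ler_wpM2r// ler_nat.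
suff main k : (k <= n.+1)%N ->
    `|H (x k) - H a - (K (x k) - K a)| <= L * h * (phi a - phi (x k)).
  have := main n.+1 (leqnn _); rewrite xn => /le_trans; apply.
  by rewrite /h mulrA [leRHS]mulrAC.
elim: k => [_|k IH kn]; first by rewrite /x mul0r addr0 !subrr normr0 mulr0.
have xx : x k <= x k.+1 by rewrite -subr_ge0 xS.
have /andP[E0] := EL _ _ (ax k) xx (xb _ kn); rewrite xS => E1.
have /andP[H1 H2] := HP _ _ (ax k) xx (xb _ kn).
have /andP[K1 K2] := KP _ _ (ax k) xx (xb _ kn).
have phi1 := phi_le _ _ (ax k) xx (xb _ kn).
have {}IH := IH (ltnW kn).
have -> : H (x k.+1) - H a - (K (x k.+1) - K a) =
  (H (x k) - H a - (K (x k) - K a)) +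
  ((H (x k.+1) - H (x k)) - (K (x k.+1) - K (x k))) by ring.
apply: (le_trans (ler_normD _ _)).
rewrite (_ : phi a - phi (x k.+1) = (phi a - phi (x k)) + (phi (x k) - phi (x k.+1)));
  last by ring.
rewrite mulrDr; apply: lerD => //.
apply: (@le_trans _ _ ((E (x k.+1) - E (x k)) * (phi (x k) - phi (x k.+1)))).
  by rewrite ler_norml mulrBr; apply/andP; split; lra.
by rewrite ler_wpM2r// subr_ge0.
Qed.

(** By Cauchy's mean value theorem the ratio of the increments of [K] and [E] is the ratio of their
    derivatives, hence [phi], at some point of the interval. Monotonicity of [phi] compares it with
    the endpoint values. *)
Lemma increment_between (R : realType) (K E dE phi : R -> R) (a b : R) :
  a <= b ->
  (forall x, a <= x <= b -> is_derive x 1 E (dE x) /\ 0 < dE x) ->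
  (forall x, a <= x <= b -> is_derive x 1 K (dE x * phi x)) ->
  (forall x y, a <= x -> x <= y -> y <= b -> phi y <= phi x) ->
  (E b - E a) * phi b <= K b - K a <= (E b - E a) * phi a.
Proof.
move=> ab dEP dKP phi_le.
have [<-|neab] := eqVneq a b; first by rewrite !subrr !mul0r lexx.
have {}ab : a < b by rewrite lt_neqAle neab.
have itvP x : x \in `]a, b[%R -> a <= x <= b.
  by rewrite in_itv/= => /andP[/ltW -> /ltW ->].
have cont (f df : R -> R) : (forall x, a <= x <= b -> is_derive x 1 f (df x)) ->
    {within `[a, b], continuous f}.
  move=> fdf; apply: derivable_within_continuous => x; rewrite in_itv/= => xab.
  by have [] := fdf _ xab.
have cE := cont _ _ (fun x xab => (dEP x xab).1).
have [c] := cauchy_MVT ab (cont _ _ dKP) cE (fun x xab => dKP x (itvP x xab))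
  (fun x xab => (dEP x (itvP x xab)).1)
  (fun x xab => lt0r_neq0 (dEP x (itvP x xab)).2).
have [e eab EE] := MVT ab (fun x xab => (dEP x (itvP x xab)).1) cE.
have E0 : 0 < E b - E a by rewrite EE mulr_gt0 ?subr_gt0// (dEP e (itvP e eab)).2.
move=> /itvP/[dup] cab /andP[ac cb].
rewrite mulrAC divff ?mul1r; last exact: lt0r_neq0 (dEP c cab).2.
move=> phic; have -> : K b - K a = (E b - E a) * phi c.
  by rewrite phic mulrC divfK// gt_eqF.
by rewrite !ler_pM2l// !phi_le//.
Qed.

(** * Conditioning on an exponential variable *)

Section Probability.
Context (R : realType) (d : measure_display) (T : measurableType d).
Variable P : probability T R.

(** Real-valued, so that [ring], [field] and [lra] apply to identities between probabilities. *)
Definition pr (A : set T) : R := fine (P A).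

Lemma prE A : measurable A -> P A = (pr A)%:E.
Proof. by move=> mA; rewrite fineK// fin_num_measure. Qed.

Lemma pr_ge0 A : 0 <= pr A. Proof. exact: fine_ge0. Qed.

Lemma pr_setT : pr setT = 1. Proof. by rewrite /pr probability_setT. Qed.

Lemma pr_set0 : pr set0 = 0. Proof. by rewrite /pr measure0. Qed.

Lemma le_pr A B : measurable A -> measurable B -> A `<=` B -> pr A <= pr B.
Proof. by move=> mA mB AB; rewrite -lee_fin -!prE// le_measure// inE. Qed.

Lemma prU A B : measurable A -> measurable B -> A `&` B = set0 ->
  pr (A `|` B) = pr A + pr B.
Proof.
move=> mA mB AB0; apply: EFin_inj; rewrite EFinD -!prE ?measureU//.
exact: measurableU.
Qed.

Lemma prD A B : measurable A -> measurable B -> pr (A `\` B) = pr A - pr (A `&` B).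
Proof.
move=> mA mB; have mD : measurable (A `\` B) by exact: measurableD.
have mI : measurable (A `&` B) by exact: measurableI.
apply/eqP; rewrite -subr_eq opprK; apply/eqP; rewrite -prU//.
  by rewrite setUC setUIDK.
by apply/seteqP; split => // t /= [[_ nB] [_ /nB]].
Qed.

Lemma measurable_set_lt (f g : T -> R) : measurable_fun setT f ->
  measurable_fun setT g -> measurable [set t | f t < g t].
Proof.
move=> mf mg; have := measurable_fun_ltr mf mg measurableT (I : measurable [set true]).
by rewrite setTI.
Qed.

Lemma measurable_set_le (f g : T -> R) : measurable_fun setT f ->
  measurable_fun setT g -> measurable [set t | f t <= g t].
Proof.
move=> mf mg; have := measurable_fun_ler mf mg measurableT (I : measurable [set true]).
by rewrite setTI.
Qed.

Section Mixture.
Variables (X : T -> R) (F : R -> set T) (r a b : R) (phi K : R -> R).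
Hypotheses (mX : measurable_fun setT X) (mF : forall y, measurable (F y)).
Hypothesis mFX : measurable [set t | F (X t) t].
Hypotheses (r0 : 0 < r) (ab : a <= b).
Hypothesis F_monotone :
  (forall x y, a <= x -> x <= y -> y <= b -> F y `<=` F x) \/
  (forall x y, a <= x -> x <= y -> y <= b -> F x `<=` F y).
Hypothesis prF : forall x y, a <= x <= b -> a <= y <= b ->
  pr ([set t | x < X t] `&` F y) = expR (- (r * x)) * phi y.
Hypothesis derK : forall x, a <= x <= b ->
  is_derive x 1 K (r * expR (- (r * x)) * phi x).

Let mgt x : measurable [set t | x < X t].
Proof. exact: measurable_set_lt. Qed.

Let mitv x y : measurable [set t | x < X t <= y].
Proof.
rewrite (_ : [set t | _] = [set t | x < X t] `&` [set t | X t <= y]).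
  by apply: measurableI => //; exact: measurable_set_le.
by apply/seteqP; split => t /= => [/andP[]//|[-> ->]].
Qed.

(** Antiderivative of the exponential density of rate [r]; it differs from the distribution function
    by the constant 1. *)
Let E (x : R) := - expR (- (r * x)).
Let H (y : R) := pr ([set t | a < X t <= y] `&` [set t | F (X t) t]).

Let pr_itv x y z : a <= x -> x <= y -> y <= b -> a <= z <= b ->
  pr ([set t | x < X t <= y] `&` F z) = (E y - E x) * phi z.
Proof.
move=> ax xy yb zab; have yab : a <= y <= b by rewrite yb (le_trans ax).
have xab : a <= x <= b by rewrite ax (le_trans xy).
rewrite (_ : _ `&` _ =
    ([set t | x < X t] `&` F z) `\` ([set t | y < X t] `&` F z)).
  rewrite prD; [|exact: measurableI..].
  rewrite (_ : _ `&` _ `&` (_ `&` _) = [set t | y < X t] `&` F z).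
    by rewrite !prF// /E; ring.
  apply/seteqP; split => t /= [].
    by move=> _ [].
  by move=> yX Fz; do !split => //; exact: le_lt_trans yX.
apply/seteqP; split => t /=.
  by move=> [/andP[xX Xy] Fz]; split => // -[]; rewrite ltNge Xy.
by move=> [[-> Fz] /not_andP[/negP|//]]; rewrite -leNgt.
Qed.

Let H_incr x y : a <= x -> x <= y -> y <= b ->
  H y - H x = pr ([set t | x < X t <= y] `&` [set t | F (X t) t]).
Proof.
move=> ax xy yb; apply/eqP; rewrite subr_eq addrC -prU; last first.
- apply/seteqP; split => // t /= [[/andP[_ Xx] _] [/andP[xX _] _]].
  by move: Xx; rewrite leNgt xX.
- exact: measurableI.
- exact: measurableI.
apply/eqP; congr pr; apply/seteqP; split => t /=.
  move=> [/andP[aX Xy] FX]; have [Xx|xX] := leP (X t) x.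
    by left; rewrite aX.
  by right; rewrite Xy.
move=> [[/andP[aX Xx] FX]|[/andP[xX Xy] FX]]; split => //.
  by rewrite aX (le_trans Xx).
by rewrite Xy (le_lt_trans ax).
Qed.

Let E_derive (x : R) : is_derive x 1 E (r * expR (- (r * x))).
Proof.
by apply: is_derive_eq; rewrite /GRing.scale /= mulr1 mulrN opprK mulrC.
Qed.

Let dE_gt0 (x : R) : 0 < r * expR (- (r * x)).
Proof. by rewrite mulr_gt0// expR_gt0. Qed.

(** Supplies the Lipschitz constant asked for by [sandwich_eq]: the density is largest at [a]. *)
Let E_incr x y : a <= x -> x <= y -> y <= b ->
  0 <= E y - E x <= r * expR (- (r * a)) * (y - x).
Proof.
move=> ax xy yb; rewrite /E opprK addrC subr_ge0 ler_expR lerN2 ler_pM2l// xy /=.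
have -> : expR (- (r * y)) = expR (- (r * x)) * expR (- (r * (y - x))).
  by rewrite -expRD; congr expR; ring.
have := expR_ge1Dx (- (r * (y - x))) => e1x.
have -> : forall u v : R, u - u * v = u * (1 - v) by move=> *; ring.
rewrite -mulrA mulrCA; apply: ler_pM; rewrite ?expR_ge0//.
- by rewrite subr_ge0 expR_le1 oppr_le0 mulr_ge0// ?subr_ge0// ltW.
- by rewrite ler_expR lerN2 ler_pM2l.
- by lra.
Qed.

(* Plays the part of conditioning on [X]: both the probability, as a function of
   [b], and [K] have increments between those of the exponential distribution
   function times the extreme values of [phi]. *)
Lemma pr_mixture : pr ([set t | a < X t <= b] `&` [set t | F (X t) t]) = K b - K a.
Proof.
have Ha : H a = 0.
  rewrite /H (_ : _ `&` _ = set0) ?pr_set0//; apply/seteqP; split => // t /=.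
  by move=> [/andP[aX Xa] _]; move: Xa; rewrite leNgt aX.
rewrite -[LHS]subr0 -/(H b) -Ha.
have [->|neab] := eqVneq a b; first by rewrite !subrr.
have {neab}altb : a < b by rewrite lt_neqAle neab.
have Eab : 0 < E b - E a.
  by rewrite /E opprK addrC subr_gt0 ltr_expR ltrN2 ltr_pM2l.
have mIF x y z : measurable ([set t | x < X t <= y] `&` F z) by exact: measurableI.
have mIFX x y : measurable ([set t | x < X t <= y] `&` [set t | F (X t) t]).
  exact: measurableI.
case: F_monotone => Fle.
- have phi_le x y : a <= x -> x <= y -> y <= b -> phi y <= phi x.
    move=> ax xy yb; rewrite -(ler_pM2l Eab) -!pr_itv//; last 2 first.
    - by rewrite ax (le_trans xy).
    - by rewrite yb (le_trans ax).
    by apply: le_pr => //; apply: setIS; exact: Fle.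
  (* On a cell, [x < X t <= y] places [F (X t)] between [F y] and [F x], so [pr_itv] sandwiches the
     increment of [H]. *)
  apply: (@sandwich_eq _ _ _ E phi _ _ (r * expR (- (r * a)))) => // x y ax xy yb.
  + have xab : a <= x <= b by rewrite ax (le_trans xy).
    have yab : a <= y <= b by rewrite yb (le_trans ax).
    rewrite H_incr// -!pr_itv//; apply/andP; split; apply: le_pr => // t /=.
      move=> [/[dup] Xt /andP[xX Xy] Fy]; split => //.
      by apply: (Fle _ y) => //; exact: le_trans (ltW xX).
    move=> [/[dup] Xt /andP[xX Xy] Fy]; split => //.
    by apply: Fle Fy => //; [exact: ltW|exact: le_trans Xy _].
  + apply: (@increment_between _ _ _ (fun x => r * expR (- (r * x)))) => //.
    * move=> z /andP[xz zy]; apply: derK; by rewrite (le_trans ax)//= (le_trans zy).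
    * move=> u v xu uv vy; apply: phi_le => //; first exact: le_trans xu.
      exact: le_trans yb.
- have phi_le x y : a <= x -> x <= y -> y <= b -> phi x <= phi y.
    move=> ax xy yb; rewrite -(ler_pM2l Eab) -!pr_itv//; last 2 first.
    - by rewrite yb (le_trans ax).
    - by rewrite ax (le_trans xy).
    by apply: le_pr => //; apply: setIS; exact: Fle.
  (* For an increasing family, negating [H], [K] and [phi] restores the monotonicity that
     [sandwich_eq] demands. *)
  apply: oppr_inj; rewrite !opprB -[H a]opprK -[K a]opprK ![- - _ - _]addrC.
  apply: (@sandwich_eq _ (fun x => - H x) (fun x => - K x) E (fun x => - phi x)
    _ _ (r * expR (- (r * a)))) => //=.
  + by move=> x y ax xy yb; rewrite lerN2 phi_le.
  + move=> x y ax xy yb.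
    have xab : a <= x <= b by rewrite ax (le_trans xy).
    have yab : a <= y <= b by rewrite yb (le_trans ax).
    have -> : - H y - - H x = - (H y - H x) by ring.
    rewrite !mulrN !lerN2 H_incr// -!pr_itv// andbC.
    apply/andP; split; apply: le_pr => // t /=.
      move=> [/[dup] Xt /andP[xX Xy] Fy]; split => //.
      by apply: Fle Fy => //; [exact: ltW|exact: le_trans Xy _].
    move=> [/[dup] Xt /andP[xX Xy] Fy]; split => //.
    by apply: (Fle _ y) Fy => //; exact: le_trans (ltW xX).
  + move=> x y ax xy yb.
    apply: (@increment_between _ (fun x => - K x) _ (fun x => r * expR (- (r * x)))
      (fun x => - phi x)) => //.
    * move=> z /andP[xz zy]; rewrite mulrN; apply: is_deriveN.
      by apply: derK; rewrite (le_trans ax)//= (le_trans zy).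
    * move=> u v xu uv vy; rewrite lerN2; apply: phi_le => //.
        exact: le_trans xu.
      exact: le_trans yb.
Qed.
End Mixture.
End Probability.

(** * Burke's theorem *)

Section Burke.
Context (R : realType) (d : measure_display) (T : measurableType d).
Variable P : probability T R.
Local Notation pr := (pr P).

Definition gt_set (f : T -> R) (x : R) : set T := [set t | x < f t].

Lemma measurable_gt_set f x : measurable_fun setT f -> measurable (gt_set f x).
Proof. by move=> mf; exact: measurable_set_lt. Qed.

(** Given [B = y], what remains is the probability of [A > y + v] and [E]; integrating over [y > u]
    gives the formula. Since [pr_mixture] handles bounded intervals, the integral is truncated at a
    level [b] beyond which the contribution is exponentially small. *)
Lemma pr_gt_add (A B : T -> R) (E : set T) (al be c u v : R) :
  measurable_fun setT A -> measurable_fun setT B -> measurable E ->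
  0 < al -> 0 < be -> 0 <= c -> 0 <= u -> 0 <= v ->
  (forall x y, 0 <= x -> 0 <= y -> pr (gt_set A x `&` gt_set B y `&` E) =
    expR (- (al * x)) * expR (- (be * y)) * c) ->
  pr (gt_set B u `&` [set t | B t + v < A t] `&` E) =
    be / (al + be) * expR (- (al * v)) * expR (- ((al + be) * u)) * c.
Proof.
move=> mA mB mE al0 be0 c0 u0 v0 ABE.
have s0 : 0 < al + be by rewrite addr_gt0.
have mBA w : measurable [set t | B t + w < A t].
  by apply: measurable_set_lt => //; exact: measurable_funD.
pose D := be / (al + be) * expR (- (al * v)) * c.
have D0 : 0 <= D by rewrite /D !mulr_ge0 ?expR_ge0 ?invr_ge0//; exact: ltW.
pose K (y : R) := - D * expR (- ((al + be) * y)).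
have trunc b : u <= b -> pr ([set t | u < B t <= b] `&`
    [set t | B t + v < A t /\ E t]) = K b - K u.
  move=> ub.
  apply: (@pr_mixture _ _ _ P B (fun y => gt_set A (y + v) `&` E) be u b
    (fun y => expR (- (al * (y + v))) * c)) => //.
  - by move=> y; apply: measurableI => //; exact: measurable_gt_set.
  - exact: (measurableI _ _ (mBA v) mE).
  - left=> x y _ xy _; apply: setSI => t; rewrite /gt_set /=; apply: le_lt_trans.
    by rewrite lerD2r.
  - move=> x y /andP[ux _] /andP[uy _].
    rewrite setIA (setIC [set _ | _]) ABE; first by ring.
      by rewrite addr_ge0// (le_trans u0).
    exact: le_trans ux.
  - move=> x _; apply: is_derive_eq; rewrite /GRing.scale /=.
    rewrite mulr1 /D (_ : - ((al + be) * x) = - (al * x) + - (be * x)); last by ring.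
    rewrite (_ : - (al * (x + v)) = - (al * x) + - (al * v)); last by ring.
    by rewrite !expRD; field; rewrite gt_eqF.
rewrite -setIA (_ : _ `&` _ = gt_set B u `&` [set t | B t + v < A t /\ E t]); last first.
  by [].
rewrite [RHS](_ : _ = - K u); last by rewrite /K /D; ring.
have mBAE : measurable [set t | B t + v < A t /\ E t]
  by exact: (measurableI _ _ (mBA v) mE).
have mBgt y : measurable (gt_set B y) by exact: measurable_gt_set.
have mitv b : measurable [set t | u < B t <= b].
  rewrite (_ : [set t | _] = gt_set B u `&` [set t | B t <= b]).
    by apply: measurableI => //; exact: measurable_set_le.
  by apply/seteqP; split => t /= => [/andP[]//|[]]; rewrite /gt_set/= => -> ->.
have splitE b : u <= b -> pr (gt_set B u `&` [set t | B t + v < A t /\ E t]) =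
    K b - K u + pr (gt_set B b `&` [set t | B t + v < A t /\ E t]).
  move=> ub; rewrite -trunc// -prU; last first.
  - apply/seteqP; split => // t [[/= /andP[_ Bb] _] [bB _]].
    by move: bB; rewrite /gt_set/= ltNge Bb.
  - exact: measurableI.
  - exact: measurableI.
  congr pr; apply/seteqP; split => t; rewrite /gt_set /=.
    move=> [uB BA]; have [Bb|bB] := leP (B t) b; last by right.
    by left; rewrite uB.
  by move=> [[/andP[->]//]|[bB]]; split => //; exact: le_lt_trans ub _.
have tail b : 0 <= b -> pr (gt_set B b `&` [set t | B t + v < A t /\ E t]) <=
    expR (- (be * b)) * c.
  move=> b0; have := ABE 0 b (lexx 0) b0.
  rewrite mulr0 oppr0 expR0 mul1r => <-; apply: le_pr.
  - exact: measurableI.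
  - by apply: measurableI => //; apply: measurableI => //; exact: measurable_gt_set.
  move=> t; rewrite /gt_set /= => -[bB [BA Et]]; do !split => //.
  apply: le_lt_trans BA; rewrite addr_ge0//; exact: le_trans (ltW bB).
apply/eqP; rewrite -subr_eq0 -normr_eq0; apply/eqP.
apply: (@eq0_le_inv _ _ ((D + c) / be)) => // n.
(* At this truncation level, [expR y >= 1 + y] makes the remainder of order [1 / n.+1], as
   [eq0_le_inv] asks. *)
pose b := u + n.+1%:R.
have ub : u <= b by rewrite lerDl.
rewrite (splitE b)// (_ : K b - K u + _ - - K u = K b +
  pr (gt_set B b `&` [set t | B t + v < A t /\ E t])); last by ring.
have b0 : 0 <= b := le_trans u0 ub.
have eb : expR (- (be * b)) <= be^-1 / n.+1%:R.
  rewrite expRN -invfM lef_pV2 ?posrE ?mulr_gt0 ?expR_gt0//.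
  apply: le_trans (expR_ge1Dx _); rewrite /b mulrDr addrA lerDr.
  by rewrite addr_ge0// mulr_ge0// ltW.
apply: (le_trans (ler_normD _ _)).
rewrite (_ : (D + c) / be / n.+1%:R = D * (be^-1 / n.+1%:R) + be^-1 / n.+1%:R * c);
  last by ring.
apply: lerD.
  rewrite /K normrM normrN ger0_norm// ger0_norm ?expR_ge0//.
  apply: ler_wpM2l => //; apply: le_trans eb.
  by rewrite ler_expR lerN2 ler_wpM2r// lerDr ltW.
rewrite ger0_norm ?pr_ge0//; apply: le_trans (tail b b0) _.
by rewrite ler_wpM2r.
Qed.

(** Crossing a unit cell: if [A] and [B] are the increments of the last-passage time along the two
    sides leaving the lower left corner and [C] is the weight of the upper right corner, this is the
    increment along the side opposite to [A]. *)
Definition burke_in (A B C : T -> R) (t : T) : R := C t + Num.max (A t - B t) 0.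

Lemma measurable_burke_in A B C : measurable_fun setT A ->
  measurable_fun setT B -> measurable_fun setT C ->
  measurable_fun setT (burke_in A B C).
Proof.
move=> mA mB mC; apply: measurable_funD => //.
apply: measurable_maxr => //; exact: measurable_funB.
Qed.

(** The event splits by the size of [C]. If [C > x], both outgoing increments exceed their levels
    automatically. If [C <= x], the first one requires [A - B > x - C >= 0]; then the second reduces
    to [C > y] and the minimum to [B > z]. That part follows from [pr_gt_add] and conditioning on
    [C]. *)
Lemma burke_le (A B C : T -> R) (E : set T) (al be c x y z : R) :
  measurable_fun setT A -> measurable_fun setT B -> measurable_fun setT C ->
  measurable E -> 0 < al -> 0 < be -> 0 <= c ->
  (forall x y z, 0 <= x -> 0 <= y -> 0 <= z ->
    pr (gt_set A x `&` gt_set B y `&` gt_set C z `&` E) =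
    expR (- (al * x)) * expR (- (be * y)) * expR (- ((al + be) * z)) * c) ->
  0 <= y -> y <= x -> 0 <= z ->
  pr (gt_set (burke_in A B C) x `&` gt_set (burke_in B A C) y `&`
      gt_set (fun t => Num.min (A t) (B t)) z `&` E) =
    expR (- (al * x)) * expR (- (be * y)) * expR (- ((al + be) * z)) * c.
Proof.
move=> mA mB mC mE al0 be0 c0 ABCE y0 yx z0.
have s0 : 0 < al + be by rewrite addr_gt0.
have mgt (f : T -> R) w : measurable_fun setT f -> measurable (gt_set f w).
  exact: measurable_gt_set.
have mBA w : measurable [set t | B t + (x - w) < A t].
  by apply: measurable_set_lt => //; exact: measurable_funD.
pose D := be / (al + be) * expR (- (al * x)) * expR (- ((al + be) * z)) * c.
(* Antiderivative of [(al + be) * D * expR (- (be * w))], the density of rate [al + be] times the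
   conditional probability [D * expR (al * w)]. *)
pose K (w : R) := - ((al + be) / be * D * expR (- (be * w))).
pose F w := gt_set B z `&` [set t | B t + (x - w) < A t] `&` E.
have mF w : measurable (F w).
  by apply: measurableI => //; apply: measurableI => //; exact: mgt.
have mFC : measurable [set t | F (C t) t].
  rewrite (_ : [set t | _] = gt_set B z `&` [set t | B t + (x - C t) < A t] `&` E) //.
  apply: measurableI => //; apply: measurableI; first exact: mgt.
  apply: measurable_set_lt => //; apply: measurable_funD => //.
  exact: measurable_funB.
have mix : pr ([set t | y < C t <= x] `&` [set t | F (C t) t]) = K x - K y.
  apply: (@pr_mixture _ _ _ P C F (al + be) y x (fun w => D * expR (al * w))) => //.
  - right=> u w _ uw _ t [[/= ? BA] ?]; do !split => //.
    by apply: le_lt_trans BA; rewrite lerD2l lerD2l lerN2.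
  - move=> u w /andP[yu ux] /andP[yw wx].
    rewrite (_ : _ `&` _ = gt_set B z `&` [set t | B t + (x - w) < A t] `&`
      (gt_set C u `&` E)); last first.
      by rewrite /F /setI; apply/seteqP; split => t /=; tauto.
    rewrite (@pr_gt_add A B _ al be (expR (- ((al + be) * u)) * c)) ?subr_ge0//.
    + rewrite /D (_ : - (al * (x - w)) = - (al * x) + al * w); last by ring.
      by rewrite expRD; ring.
    + by apply: measurableI => //; exact: mgt.
    + by rewrite mulr_ge0// expR_ge0.
    + move=> p q p0 q0; rewrite setIA ABCE//; first by ring.
      exact: le_trans yu.
  - move=> w _; apply: is_derive_eq; rewrite /GRing.scale /= mulr1.
    rewrite (_ : - ((al + be) * w) = - (al * w) + - (be * w)); last by ring.
    rewrite expRD (expRN (al * w)); field.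
    by rewrite !gt_eqF ?expR_gt0.
have -> : gt_set (burke_in A B C) x `&` gt_set (burke_in B A C) y `&`
      gt_set (fun t => Num.min (A t) (B t)) z `&` E =
    (gt_set A z `&` gt_set B z `&` gt_set C x `&` E) `|`
    ([set t | y < C t <= x] `&` [set t | F (C t) t]).
  apply/seteqP; split => t; rewrite /F /gt_set /burke_in /=.
    rewrite lt_min => -[[[xA yB] /andP[zA zB]] Et].
    have [Cx|xC] := leP (C t) x; [right|left => //].
    have AB : x - C t < A t - B t.
      by move: xA; rewrite -ltrBlDl lt_max => /orP[//|]; lra.
    have yC : y < C t.
      by move: yB; rewrite -ltrBlDl lt_max => /orP[|]; lra.
    by split; [rewrite yC|do !split => //; lra].
  rewrite lt_min => -[[[[-> ->] xC] Et]|[/andP[yC Cx] [[zB BA] Et]]].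
    split=> //; split=> //; split.
      by apply: (lt_le_trans xC); rewrite lerDl le_max lexx orbT.
    by apply: (le_lt_trans yx); apply: (lt_le_trans xC); rewrite lerDl le_max lexx orbT.
  split=> //; split; last by apply/andP; split => //; lra.
  split; first by rewrite -ltrBlDl lt_max; apply/orP; left; lra.
  by apply: (lt_le_trans yC); rewrite lerDl le_max lexx orbT.
rewrite prU.
- rewrite mix ABCE//; last exact: le_trans yx.
  rewrite /K /D; set ex := expR (- (al * x)).
  rewrite (_ : - ((al + be) * x) = - (al * x) + - (be * x)); last by ring.
  rewrite (_ : - ((al + be) * z) = - (al * z) + - (be * z)); last by ring.
  rewrite !expRD -/ex; field.
  by rewrite !gt_eqF.
- by do 3?[apply: measurableI => //]; exact: mgt.
- apply: measurableI => //.
  rewrite (_ : [set t | _] = gt_set C y `&` [set t | C t <= x]).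
    by apply: measurableI; [exact: mgt|exact: measurable_set_le].
  by apply/seteqP; split => t /= => [/andP[]//|[]]; rewrite /gt_set/= => -> ->.
- apply/seteqP; split => // t [[[_ xC] _] [/= /andP[_ Cx] _]].
  by move: xC; rewrite /gt_set/= ltNge Cx.
Qed.

(** Exchanging [A] with [B] and [al] with [be] reduces [x <= y] to the previous case. The event [E]
    stands for all other variables: the new triple keeps both the law of the old one and its
    independence of them. *)
Lemma burke (A B C : T -> R) (E : set T) (al be c x y z : R) :
  measurable_fun setT A -> measurable_fun setT B -> measurable_fun setT C ->
  measurable E -> 0 < al -> 0 < be -> 0 <= c ->
  (forall x y z, 0 <= x -> 0 <= y -> 0 <= z ->
    pr (gt_set A x `&` gt_set B y `&` gt_set C z `&` E) =
    expR (- (al * x)) * expR (- (be * y)) * expR (- ((al + be) * z)) * c) ->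
  0 <= x -> 0 <= y -> 0 <= z ->
  pr (gt_set (burke_in A B C) x `&` gt_set (burke_in B A C) y `&`
      gt_set (fun t => Num.min (A t) (B t)) z `&` E) =
    expR (- (al * x)) * expR (- (be * y)) * expR (- ((al + be) * z)) * c.
Proof.
move=> mA mB mC mE al0 be0 c0 ABCE x0 y0 z0.
have [yx|/ltW xy] := leP y x; first exact: (burke_le mA mB mC mE).
have -> : (fun t => Num.min (A t) (B t)) = (fun t => Num.min (B t) (A t)).
  by apply/funext => t; rewrite minC.
rewrite [X in X `&` _ `&` _]setIC (burke_le mB mA mC mE be0 al0 c0)//.
  by rewrite (addrC be); ring.
move=> p q r p0 q0 r0; rewrite [X in X `&` _ `&` _]setIC ABCE// (addrC be).
by ring.
Qed.
End Burke.

(** * Joint tails of finite families of independent exponential variables *)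

Section ExpTails.
Context (R : realType) (d : measure_display) (T : measurableType d).
Variable P : probability T R.
Local Notation pr := (pr P).

Lemma pr_setI1 A B : measurable A -> measurable B -> pr B = 1 ->
  pr (A `&` B) = pr A.
Proof.
move=> mA mB B1; apply/eqP; rewrite eq_le le_pr//=; last exact: measurableI.
have mAB : measurable (A `\` B) by exact: measurableD.
have : pr (A `\` B) + pr B <= 1.
  rewrite -prU//; last first.
    by apply/seteqP; split => // t [[]].
  rewrite -[leRHS](pr_setT P); apply: le_pr => //; exact: measurableU.
by rewrite B1 prD//; lra.
Qed.

Lemma pr_setI0 A B : measurable A -> measurable B -> pr B = 1 ->
  pr (A `\` B) = 0.
Proof. by move=> mA mB B1; rewrite prD// pr_setI1// subrr. Qed.

Variable I : eqType.
Implicit Types (s : seq I) (X : I -> T -> R) (r u : I -> R).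

Definition tails s X u : set T := [set t | all (fun i => u i < X i t) s].

Lemma tails_cons a s X u : tails (a :: s) X u = gt_set (X a) (u a) `&` tails s X u.
Proof.
by apply/seteqP; split => t; rewrite /tails /=;
  [move=> /andP|move=> [? ?]; apply/andP].
Qed.

Lemma tails_cat s1 s2 X u : tails (s1 ++ s2) X u = tails s1 X u `&` tails s2 X u.
Proof.
by apply/seteqP; split => t; rewrite /tails /= all_cat;
  [move=> /andP|move=> [? ?]; apply/andP].
Qed.

Lemma tails_perm s1 s2 X u : perm_eq s1 s2 -> tails s1 X u = tails s2 X u.
Proof. by move=> s12; apply/funext => t; rewrite /tails /= (perm_all _ s12). Qed.

Lemma eq_tails s X Y u v : {in s, X =1 Y} -> {in s, u =1 v} ->
  tails s X u = tails s Y v.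
Proof.
move=> XY uv; apply/funext => t; rewrite /tails /=; congr is_true.
by apply: eq_in_all => i si; rewrite XY// uv.
Qed.

Lemma measurable_tails s X u : (forall i, measurable_fun setT (X i)) ->
  measurable (tails s X u).
Proof.
move=> mX; elim: s => [|a s IH]; last first.
  by rewrite tails_cons; apply: measurableI => //; exact: measurable_gt_set.
by rewrite (_ : tails _ _ _ = setT)//; apply/seteqP; split.
Qed.

(* Independence is only used through joint tails at nonnegative levels, so that
   no product measure is needed. *)
Definition exp_tails s X r := [/\ forall i, measurable_fun setT (X i),
  forall i t, 0 <= X i t &
  forall u, (forall i, 0 <= u i) ->
    pr (tails s X u) = \prod_(i <- s) expR (- (r i * u i))].

Lemma exp_tails_perm s1 s2 X r : perm_eq s1 s2 ->
  exp_tails s1 X r -> exp_tails s2 X r.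
Proof.
move=> s12 [mX X0 XE]; split=> // u u0.
by rewrite -(tails_perm _ _ s12) XE// (perm_big _ s12).
Qed.

Lemma pr_tails0 s X r : exp_tails s X r -> pr (tails s X (fun=> 0)) = 1.
Proof.
by move=> [_ _ ->]//; apply: big1 => i _; rewrite mulr0 oppr0 expR0.
Qed.

(** Level [0] at the indices of [s1] costs nothing, because the variables are almost surely
    positive. *)
Lemma exp_tails_catr s1 s2 X r : uniq (s1 ++ s2) ->
  exp_tails (s1 ++ s2) X r -> exp_tails s2 X r.
Proof.
rewrite cat_uniq => /and3P[_ /hasPn s12 _] e12; have [mX X0 XE] := e12.
split=> // u u0; pose v i := if i \in s1 then 0 else u i.
have v2 : {in s2, v =1 u} by move=> i /s12 /= /negbTE; rewrite /v => ->.
have v1 : {in s1, v =1 fun=> 0} by rewrite /v => i ->.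
rewrite -(@pr_setI1 _ (tails s1 X (fun=> 0))); try exact: measurable_tails.
  rewrite setIC -(@eq_tails _ X _ v)// -(@eq_tails s2 X _ v)// -tails_cat XE.
    rewrite big_cat/= big1_seq ?mul1r.
      by apply: eq_big_seq => i /v2 ->.
    by move=> i /= /v1 ->; rewrite mulr0 oppr0 expR0.
  by move=> i; rewrite /v; case: ifP.
apply/eqP; rewrite eq_le; apply/andP; split.
  by rewrite -(pr_setT P); apply: le_pr => //; exact: measurable_tails.
rewrite -(pr_tails0 e12) tails_cat; apply: le_pr => //.
  by apply: measurableI; exact: measurable_tails.
exact: measurable_tails.
Qed.

Lemma exp_tails_sub s1 s X r : uniq s -> uniq s1 -> {subset s1 <= s} ->
  exp_tails s X r -> exp_tails s1 X r.
Proof.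
move=> us us1 s1s; have ss1 : perm_eq s ([seq i <- s | i \notin s1] ++ s1).
  apply: uniq_perm => //; last first.
    move=> i; rewrite mem_cat mem_filter.
    by have [/s1s ->|] := boolP (i \in s1); rewrite ?andbF ?orbF.
  rewrite cat_uniq filter_uniq// us1 andbT; apply/hasPn => i i1 /=.
  by rewrite mem_filter negb_and i1.
move=> /(exp_tails_perm ss1); apply: exp_tails_catr.
by rewrite -(perm_uniq ss1).
Qed.

(** The minimum of the two incoming increments takes the slot of the consumed weight. Index set and
    rates are thus unchanged, which allows the step to be iterated. *)
Definition burke_step (a b c : I) X : I -> T -> R := fun i =>
  if i == a then burke_in (X a) (X b) (X c)
  else if i == b then burke_in (X b) (X a) (X c)
  else if i == c then (fun t => Num.min (X a t) (X b t)) else X i.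

Lemma exp_tails_burke s a b c X r : uniq s -> a \in s -> b \in s -> c \in s ->
  a != b -> a != c -> b != c -> 0 < r a -> 0 < r b -> r c = r a + r b ->
  exp_tails s X r -> exp_tails s (burke_step a b c X) r.
Proof.
move=> us sa sb sc ab ac bc ra rb rc eX.
have [s' ss'] : exists s', perm_eq s [:: a, b, c & s'].
  exists (rem c (rem b (rem a s))).
  apply: (perm_trans (perm_to_rem sa)); rewrite perm_cons.
  have sb' : b \in rem a s by rewrite mem_rem_uniq// inE eq_sym ab.
  apply: (perm_trans (perm_to_rem sb')); rewrite perm_cons; apply: perm_to_rem.
  by rewrite mem_rem_uniq ?rem_uniq// inE eq_sym bc mem_rem_uniq// inE eq_sym ac.
rewrite (perm_uniq ss') in us.
apply: (@exp_tails_perm [:: a, b, c & s']); first by rewrite perm_sym.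
have [mX X0 XE] := exp_tails_perm ss' eX.
have Ya : burke_step a b c X a = burke_in (X a) (X b) (X c).
  by rewrite /burke_step eqxx.
have Yb : burke_step a b c X b = burke_in (X b) (X a) (X c).
  by rewrite /burke_step eqxx eq_sym (negbTE ab).
have Yc : burke_step a b c X c = (fun t => Num.min (X a t) (X b t)).
  by rewrite /burke_step eqxx eq_sym (negbTE ac) eq_sym (negbTE bc).
move: us => /= /and4P[]; rewrite !inE !negb_or => /and3P[_ _ as'] /andP[_ bs'] cs' us'.
have neq i e : i \in s' -> e \notin s' -> (i == e) = false.
  by move=> si es'; apply/eqP => ie; rewrite -ie si in es'.
have Ys i : i \in s' -> burke_step a b c X i = X i.
  by move=> si; rewrite /burke_step !neq.
split.
- move=> i; rewrite /burke_step; case: ifP => _; first exact: measurable_burke_in.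
  case: ifP => _; first exact: measurable_burke_in.
  by case: ifP => _ //; exact: measurable_minr.
- move=> i t; rewrite /burke_step /burke_in.
  case: ifP => _; first by rewrite addr_ge0// le_max lexx orbT.
  case: ifP => _; first by rewrite addr_ge0// le_max lexx orbT.
  by case: ifP => _ //; rewrite le_min !X0.
move=> u u0; rewrite !tails_cons Ya Yb Yc (@eq_tails s' _ X _ u)//.
rewrite !big_cons !setIA rc !mulrA; apply: burke => //.
- exact: measurable_tails.
- by apply: prodr_ge0 => i _; exact: expR_ge0.
move=> x y z x0 y0 z0.
(* The hypothesis of [burke] needs arbitrary levels in the three slots of the cell, with the levels
   [u] kept elsewhere. *)
pose v i := if i == a then x else if i == b then y else if i == c then z else u i.
have vs : {in s', v =1 u}.
  by move=> i si; rewrite /v !neq.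
have va : v a = x by rewrite /v eqxx.
have vb : v b = y by rewrite /v eqxx eq_sym (negbTE ab).
have vc : v c = z by rewrite /v eqxx eq_sym (negbTE ac) eq_sym (negbTE bc).
have v0 i : 0 <= v i by rewrite /v; do 3?[case: ifP => // _].
have := XE v v0; rewrite !tails_cons !big_cons va vb vc !setIA !mulrA rc.
rewrite (@eq_tails s' X X v u)// => ->; congr (_ * _).
by apply: eq_big_seq => i /vs ->.
Qed.

End ExpTails.

(** * Sums of independent exponential variables *)

Section PoissonSums.
Variable R : realType.

(** Times [expR (- y)], this is the probability that a Poisson variable of mean [y] is below [n],
    equivalently that a sum of [n] independent rate 1 exponentials exceeds [y]. *)
Definition exp_sum (n : nat) (y : R) : R := \sum_(0 <= k < n) y ^+ k / k`!%:R.

Lemma exp_sumS0 n : exp_sum n.+1 0 = 1.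
Proof.
rewrite /exp_sum big_nat_recl// big1 ?addr0 ?expr0 ?divr1// => k _.
by rewrite expr0n mul0r.
Qed.

Lemma is_derive_exp_sum n (y : R) :
  is_derive y 1 (exp_sum n.+1) (exp_sum n y).
Proof.
elim: n => [|n IH].
  rewrite [exp_sum 1](_ : _ = cst 1); last first.
    by apply/funext => z; rewrite /exp_sum big_nat1 expr0 divr1.
  by rewrite /exp_sum big_geq//; exact: is_derive_cst.
rewrite [exp_sum n.+2](_ : _ =
  exp_sum n.+1 + (fun z => (n.+1)`!%:R^-1 *: z ^+ n.+1)); last first.
  apply/funext => z; rewrite /exp_sum [LHS]big_nat_recr//=.
  by congr (_ + _); rewrite /GRing.scale /= mulrC.
rewrite [exp_sum n.+1 y](_ : _ = exp_sum n y + y ^+ n / n`!%:R); last first.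
  by rewrite /exp_sum big_nat_recr.
apply: is_deriveD.
have -> : (fun z : R => (n.+1)`!%:R^-1 *: z ^+ n.+1) =
    (n.+1)`!%:R^-1 \*: (id ^+ n.+1 : R -> R).
  by apply/funext => z; rewrite fctE.
apply: is_derive_eq.
rewrite /GRing.scale /= mulr1 factS natrM.
by field; rewrite addrC natr1 !pnatr_eq0 -lt0n fact_gt0.
Qed.

Lemma exp_sum_cvg (y : R) : exp_sum n y @[n --> \oo] --> expR y.
Proof. exact: is_cvg_series_exp_coeff. Qed.

Lemma exp_sum_le_expR n (y : R) : 0 <= y -> exp_sum n y <= expR y.
Proof.
move=> y0; rewrite -(cvg_lim _ (@exp_sum_cvg y))//.
apply: nondecreasing_cvgn_le; last by apply/cvg_ex; exists (expR y); exact: exp_sum_cvg.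
apply/nondecreasing_seqP => m; rewrite /exp_sum [leRHS]big_nat_recr//= lerDl.
by rewrite divr_ge0// exprn_ge0.
Qed.

(** Each term [k < n] is multiplied by [expR (th * (n - k)) >= 1], after which the sum is a
    truncated exponential series. *)
Lemma exp_sum_le_chernoff n (y th : R) : 0 <= y -> 0 <= th ->
  exp_sum n y <= expR (th * n%:R + y * expR (- th)).
Proof.
move=> y0 th0; have ye0 : 0 <= y * expR (- th) by rewrite mulr_ge0 ?expR_ge0.
rewrite expRD; apply: (@le_trans _ _ (expR (th * n%:R) * exp_sum n (y * expR (- th)))).
  rewrite /exp_sum big_distrr/= !big_mkord; apply: ler_sum => k _.
  rewrite exprMn -expRM_natr [leRHS](_ : _ =
    expR (th * n%:R) * expR (- th * k%:R) * (y ^+ k / k`!%:R)); last by ring.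
  rewrite -expRD ler_peMl ?divr_ge0 ?exprn_ge0//.
  rewrite (le_trans _ (expR_ge1Dx _))// lerDl mulNr -mulrBr.
  by rewrite mulr_ge0// subr_ge0 ler_nat ltnW.
by apply: ler_wpM2l; rewrite ?expR_ge0// exp_sum_le_expR.
Qed.

(** The missing terms [k >= n] are multiplied by [expR (th * (k - n)) >= 1]; the estimate is made on
    partial sums and passed to the limit. *)
Lemma expR_sub_exp_sum_le n (y th : R) : 0 <= y -> 0 <= th ->
  expR y - exp_sum n y <= expR (- (th * n%:R) + y * expR th).
Proof.
move=> y0 th0; have ye0 : 0 <= y * expR th by rewrite mulr_ge0 ?expR_ge0.
rewrite lerBlDr; rewrite -(cvg_lim _ (@exp_sum_cvg y))//.
apply: limr_le; first by apply/cvg_ex; exists (expR y); exact: exp_sum_cvg.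
exists n => // m /= nm.
rewrite -lerBlDr expRD.
apply: (@le_trans _ _ (expR (- (th * n%:R)) * exp_sum m (y * expR th))); last first.
  by apply: ler_wpM2l; rewrite ?expR_ge0// exp_sum_le_expR.
rewrite /exp_sum (big_cat_nat _ nm)//= [X in X - _]addrC addrK.
rewrite [leRHS]big_distrr/= [leRHS](big_cat_nat _ nm)//=.
apply: ler_wpDl.
  by apply: sumr_ge0 => k _; rewrite mulr_ge0 ?expR_ge0// divr_ge0 ?exprn_ge0.
rewrite !big_nat; apply: ler_sum => k /andP[nk _].
rewrite exprMn -expRM_natr [leRHS](_ : _ =
  expR (- (th * n%:R)) * expR (th * k%:R) * (y ^+ k / k`!%:R)); last by ring.
rewrite -expRD ler_peMl ?divr_ge0 ?exprn_ge0//.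
rewrite (le_trans _ (expR_ge1Dx _))// lerDl addrC -mulrBr.
by rewrite mulr_ge0// subr_ge0 ler_nat.
Qed.

End PoissonSums.

(** * Tail of a sum of equal-rate exponential variables *)

Section GammaSums.
Context (R : realType) (d : measure_display) (T : measurableType d).
Variables (P : probability T R) (I : eqType).
Local Notation pr := (pr P).
Implicit Types (s : seq I) (X : I -> T -> R) (r u : I -> R).

Lemma measurable_sum_seq s X : (forall i, measurable_fun setT (X i)) ->
  measurable_fun setT (fun t => \sum_(i <- s) X i t).
Proof. by move=> mX; exact: measurable_sum. Qed.

(** Induction on [s1], conditioning on its head [a]: the induction hypothesis is used with [a] moved
    to [s2], which is why the tail event of [s2] is carried along. The mixture can be integrated
    because [exp_sum n] is the derivative of [exp_sum n.+1]. *)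
Lemma pr_sum_gt s1 s2 X r u (rho x : R) : uniq (s1 ++ s2) ->
  exp_tails P (s1 ++ s2) X r -> 0 < rho -> {in s1, forall i, r i = rho} ->
  (forall i, 0 <= u i) -> 0 <= x ->
  pr ([set t | x < \sum_(i <- s1) X i t] `&` tails s2 X u) =
    expR (- (rho * x)) * exp_sum (size s1) (rho * x) *
    \prod_(i <- s2) expR (- (r i * u i)).
Proof.
move=> + + rho0; elim: s1 s2 u x => [|a s1 IH] s2 u x uss eX rs u0 x0.
  rewrite (_ : _ `&` _ = set0) ?pr_set0 /exp_sum ?big_geq ?mulr0 ?mul0r//.
  by apply/seteqP; split => // t [/=]; rewrite big_nil ltNge x0.
have [mX X0 _] := eX.
have pss : perm_eq ((a :: s1) ++ s2) (s1 ++ a :: s2).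
  by rewrite -[a :: s2]cat1s catA perm_cat2r -cat1s perm_catC.
have eX' := exp_tails_perm pss eX.
have uss' : uniq (s1 ++ a :: s2) by rewrite -(perm_uniq pss).
have uas2 : uniq (a :: s2) by move: uss'; rewrite cat_uniq => /and3P[].
have eX2 : exp_tails P (a :: s2) X r := exp_tails_catr uss' eX'.
have {}IH v y : (forall i, 0 <= v i) -> 0 <= y ->
    pr ([set t | y < \sum_(i <- s1) X i t] `&` tails (a :: s2) X v) =
    expR (- (rho * y)) * exp_sum (size s1) (rho * y) *
    \prod_(i <- a :: s2) expR (- (r i * v i)).
  by move=> v0 y0; apply: IH => // i si; apply: rs; rewrite inE si orbT.
set c := \prod_(i <- s2) _.
pose S t := \sum_(i <- s1) X i t.
have mS : measurable_fun setT S by exact: measurable_sum_seq.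
pose E := tails s2 X u.
have mE : measurable E by exact: measurable_tails.
have ra : r a = rho by apply: rs; rewrite mem_head.
pose v w i := if i == a then w else u i.
have v0 w : 0 <= w -> forall i, 0 <= v w i by move=> w0 i; rewrite /v; case: ifP.
have vs2 w : {in s2, v w =1 u}.
  move=> i si; rewrite /v; case: eqP si => // ->.
  by move: uas2 => /= /andP[/negbTE ->].
have tailsv w : tails (a :: s2) X (v w) = gt_set (X a) w `&` E.
  by rewrite tails_cons /v eqxx (@eq_tails _ _ _ _ s2 X X (v w) u)//; exact: vs2.
have prodv w : \prod_(i <- a :: s2) expR (- (r i * v w i)) = expR (- (rho * w)) * c.
  rewrite big_cons ra {1}/v eqxx; congr (_ * _).
  by apply: eq_big_seq => i /(vs2 w) ->.
have prE w : 0 <= w -> pr (gt_set (X a) w `&` E) = expR (- (rho * w)) * c.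
  by move=> w0; have [_ _ eX2'] := eX2; rewrite -tailsv eX2' ?prodv//; exact: v0.
have prXa : pr (gt_set (X a) 0) = 1.
  apply/eqP; rewrite eq_le; apply/andP; split.
    by rewrite -(pr_setT P); apply: le_pr => //; exact: measurable_gt_set.
  rewrite -(pr_tails0 eX2) tails_cons; apply: le_pr => //.
    apply: measurableI; [exact: measurable_gt_set|exact: measurable_tails].
  exact: measurable_gt_set.
pose F y := [set t | x - y < S t] `&` E.
pose K y := - (expR (- (rho * x)) * c * exp_sum (size s1).+1 (rho * (x - y))).
have mF y : measurable (F y).
  by apply: measurableI => //; exact: measurable_set_lt.
have mFX : measurable [set t | F (X a t) t].
  apply: (measurableI _ _ (_ : measurable [set t | x - X a t < S t]) mE).
  by apply: measurable_set_lt => //; exact: measurable_funB.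
have mix : pr ([set t | 0 < X a t <= x] `&` [set t | F (X a t) t]) = K x - K 0.
  apply: (pr_mixture (phi := fun y =>
      expR (- (rho * (x - y))) * exp_sum (size s1) (rho * (x - y)) * c)
    (mX a) mF mFX rho0 x0).
  - right=> y z _ yz _ t [/= xy Et]; split => //=.
    by apply: le_lt_trans xy; rewrite lerD2l lerN2.
  - move=> y z /andP[y_ge0 _] /andP[_ zx].
    rewrite (_ : _ `&` _ = [set t | x - z < S t] `&` tails (a :: s2) X (v y)).
      by rewrite IH ?prodv ?subr_ge0//; [ring|exact: v0].
    by rewrite tailsv setICA.
  - move=> y _; have Dsum := is_derive_exp_sum (size s1) (rho * (x - y)).
    have Dlin : is_derive y (1 : R) (fun z : R => rho * (x - z)) (- rho).
      by apply: is_derive_eq; rewrite /GRing.scale /=; ring.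
    have Dcomp := @is_derive1_comp _ _ (fun z : R => rho * (x - z)) y _ _ Dsum Dlin.
    pose k := - (expR (- (rho * x)) * c).
    have -> : K = k \*: (exp_sum (size s1).+1 \o (fun z : R => rho * (x - z))).
      by apply/funext => z; rewrite /K /k fctE /= /GRing.scale /= mulNr.
    apply: is_derive_eq; rewrite /GRing.scale /= /k.
    rewrite (_ : - (rho * (x - y)) = - (rho * x) + rho * y); last by ring.
    by rewrite expRD (expRN (rho * y)); field; rewrite gt_eqF ?expR_gt0.
(* Either the head is positive and at most [x], where the mixture applies, or it exceeds [x] and so
   does the sum, or it vanishes, a null event. *)
have -> : [set t | x < \sum_(i <- a :: s1) X i t] `&` tails s2 X u =
   ([set t | 0 < X a t <= x] `&` [set t | F (X a t) t]) `|`
   (gt_set (X a) x `&` E) `|`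
   (([set t | x < \sum_(i <- a :: s1) X i t] `&` E) `\` gt_set (X a) 0).
  apply/seteqP; split => t; rewrite /F /gt_set /setD /= big_cons -/(S t).
    move=> [xXS Et].
    have [Xa0|Xa0] := ltP 0 (X a t); last by right; split => //; exact/negP; rewrite -leNgt.
    left; have [Xax|xXa] := leP (X a t) x; [left|by right].
    by do !split => //; lra.
  have S0 : 0 <= S t by apply: sumr_ge0 => i _; exact: X0.
  case=> [[[/andP[Xa0 Xax] [xS Et]]|[xXa Et]]|[[xXS Et] _]] //.
    by split => //; lra.
  by split => //; lra.
have mQ : measurable ([set t | x < \sum_(i <- a :: s1) X i t] `&` E).
  by apply: measurableI => //; apply: measurable_set_lt => //; exact: measurable_sum_seq.
have mGt w : measurable (gt_set (X a) w) by exact: measurable_gt_set.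
have mitv : measurable [set t | 0 < X a t <= x].
  rewrite (_ : [set t | _] = gt_set (X a) 0 `&` [set t | X a t <= x]).
    by apply: measurableI => //; exact: measurable_set_le.
  by apply/seteqP; split => t /= => [/andP[]//|[]]; rewrite /gt_set/= => -> ->.
rewrite prU; last 3 first.
- by apply: measurableU; exact: measurableI.
- exact: measurableD.
- apply/seteqP; split => // t [[[/andP[Xa0 _] _]|[xXa _]] [_]] //.
  by apply; exact: le_lt_trans x0 xXa.
rewrite pr_setI0// addr0 prU; last 3 first.
- exact: measurableI.
- exact: measurableI.
- apply/seteqP; split => // t [[/= /andP[_ Xx] _] [xX _]].
  by move: xX; rewrite /gt_set/= ltNge Xx.
rewrite mix prE// /K subrr mulr0 exp_sumS0 subr0 /=; ring.
Qed.
Lemma pr_sum_gt1 s X r (rho x : R) : uniq s -> exp_tails P s X r ->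
  0 < rho -> {in s, forall i, r i = rho} -> 0 <= x ->
  pr [set t | x < \sum_(i <- s) X i t] =
    expR (- (rho * x)) * exp_sum (size s) (rho * x).
Proof.
move=> us eX rho0 rs x0.
have := @pr_sum_gt s [::] X r (fun=> 0) rho x; rewrite cats0 big_nil mulr1 => <- //.
by congr pr; apply/seteqP; split => t //= [].
Qed.

End GammaSums.

(** * Chernoff bounds for Poisson probabilities *)

Section Chernoff.
Variable R : realType.

Lemma chernoff_gt (xi D : R) : 0 <= xi -> 0 < D ->
  exists kappa eta : R, [/\ 0 < kappa, 0 < eta &
    forall n N : nat, n%:R <= (xi + eta) * N%:R ->
      expR (- ((xi + D) * N%:R)) * exp_sum n ((xi + D) * N%:R) <=
      expR (- (kappa * N%:R))].
Proof.
move=> xi0 D0; have xD : 0 < xi + D by lra.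
(* Of the deviation [D], one third goes to the uncertainty [eta] on [n], at most
   [th * (xi + D) = D / 3] to the second-order term in [th], and the last third gives the rate
   [kappa]. *)
pose th := D / (3 * (xi + D)).
have thE : th * (xi + D) = D / 3 by rewrite /th; field; rewrite gt_eqF.
have th0 : 0 < th by rewrite divr_gt0// mulr_gt0.
exists (th * (D / 3) / (1 + th)), (D / 3); split; [|lra|].
  by rewrite !mulr_gt0 ?invr_gt0//; lra.
move=> n N nN; have y0 : 0 <= (xi + D) * N%:R by rewrite mulr_ge0// ltW.
apply: le_trans (ler_wpM2l (expR_ge0 _) (exp_sum_le_chernoff n y0 (ltW th0))) _.
rewrite -expRD ler_expR.
have e1 : expR (- th) <= (1 + th)^-1.
  by rewrite expRN lef_pV2 ?posrE ?expR_gt0 ?expR_ge1Dx//; lra.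
have le1 : (xi + D) * N%:R * expR (- th) <= (xi + D) * N%:R * (1 + th)^-1.
  exact: ler_wpM2l.
have le2 : th * n%:R <= th * ((xi + D / 3) * N%:R) by rewrite ler_wpM2l// ltW.
suff : th * ((xi + D / 3) * N%:R) + (xi + D) * N%:R * (1 + th)^-1 - (xi + D) * N%:R
    <= - (th * (D / 3) / (1 + th) * N%:R) by lra.
rewrite -(ler_pM2r (_ : 0 < 1 + th)); last by lra.
rewrite [leRHS](_ : _ = - (th * (D / 3) * N%:R)); last by field; lra.
rewrite [leLHS](_ : _ = N%:R * th * ((xi + D / 3) * (1 + th) - (xi + D))); last first.
  by field; lra.
rewrite [leRHS](_ : _ = N%:R * th * - (D / 3)); last by ring.
apply: ler_wpM2l; first by rewrite mulr_ge0// ltW.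
have : th * (D / 3) <= th * D by rewrite ler_wpM2l ?ltW//; lra.
by lra.
Qed.

Lemma chernoff_le (xi D : R) : 0 < D -> D <= xi ->
  exists kappa eta : R, [/\ 0 < kappa, 0 < eta &
    forall n N : nat, (xi - eta) * N%:R <= n%:R ->
      1 - expR (- ((xi - D) * N%:R)) * exp_sum n ((xi - D) * N%:R) <=
      expR (- (kappa * N%:R))].
Proof.
(* The same division of [D] into thirds; [D <= xi] keeps [th] below 1, so that
   [expR th <= (1 - th)^-1]. *)
move=> D0 Dxi; pose th := D / (3 * xi).
have x0 : 0 < xi by lra.
have thE : th * xi = D / 3 by rewrite /th; field; rewrite gt_eqF.
have th0 : 0 < th by rewrite divr_gt0// mulr_gt0.
have th1 : th < 1 by rewrite /th ltr_pdivrMr ?mulr_gt0//; lra.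
exists (th * (D / 3) / (1 - th)), (D / 3); split; [|lra|].
  by rewrite !mulr_gt0 ?invr_gt0//; lra.
move=> n N nN; have y0 : 0 <= (xi - D) * N%:R by rewrite mulr_ge0// subr_ge0.
rewrite -[X in X - _](expR0 R) -{1}(addNr ((xi - D) * N%:R)) expRD -mulrBr.
apply: le_trans (ler_wpM2l (expR_ge0 _) (expR_sub_exp_sum_le n y0 (ltW th0))) _.
rewrite -expRD ler_expR.
have e1 : expR th <= (1 - th)^-1.
  rewrite -[expR th]invrK -expRN lef_pV2 ?posrE ?expR_gt0//; last by lra.
  exact: expR_ge1Dx.
have le1 : (xi - D) * N%:R * expR th <= (xi - D) * N%:R * (1 - th)^-1.
  exact: ler_wpM2l.
have le2 : th * ((xi - D / 3) * N%:R) <= th * n%:R by rewrite ler_wpM2l// ltW.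
suff : - (th * ((xi - D / 3) * N%:R)) + (xi - D) * N%:R * (1 - th)^-1 - (xi - D) * N%:R
    <= - (th * (D / 3) / (1 - th) * N%:R) by lra.
rewrite -(ler_pM2r (_ : 0 < 1 - th)); last by lra.
rewrite [leRHS](_ : _ = - (th * (D / 3) * N%:R)); last by field; lra.
rewrite [leLHS](_ : _ = N%:R * th * ((xi - D) - (xi - D / 3) * (1 - th))); last first.
  by field; lra.
rewrite [leRHS](_ : _ = N%:R * th * - (D / 3)); last by ring.
apply: ler_wpM2l; first by rewrite mulr_ge0// ltW.
have : 0 <= th * (D / 3) by rewrite mulr_ge0// ltW//; lra.
by lra.
Qed.

End Chernoff.

(** * Strong law for arrays of Gamma variables *)

Section StrongLaw.
Context (R : realType) (d : measure_display) (T : measurableType d).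
Variable P : probability T R.
Local Notation pr := (pr P).

Lemma borel_cantelli_expR (A : nat -> set T) (kappa : R) (N0 : nat) :
  (forall N, measurable (A N)) -> 0 < kappa ->
  (forall N, (N0 <= N)%N -> pr (A N) <= expR (- (kappa * N%:R))) ->
  {ae P, forall t, \forall N \near \oo, ~ A N t}.
Proof.
(* The factor [C] makes the geometric bound [C * q ^+ N] valid below [N0] too, where it is at least
   1. *)
move=> mA k0 AN; pose q := expR (- kappa); pose C := expR (kappa * N0%:R).
have q1 : q < 1 by rewrite /q expR_lt1 oppr_lt0.
have q0 : 0 < q by exact: expR_gt0.
have qN N : expR (- (kappa * N%:R)) = q ^+ N by rewrite /q -expRM_natr mulNr.
have ACq N : pr (A N) <= C * q ^+ N.
  rewrite -qN -expRD; have [NN0|NN0] := leqP N0 N.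
    apply: (le_trans (AN _ NN0)); rewrite ler_expR lerDr mulr_ge0//; exact: ltW.
  apply: (@le_trans _ _ 1).
    by rewrite -(pr_setT P); apply: le_pr.
  rewrite (le_trans _ (expR_ge1Dx _))// lerDl -mulrBr mulr_ge0 ?ltW//.
  by rewrite subr_gt0 ltr_nat.
have sumA : (\sum_(N <oo) P (A N) < +oo)%E.
  apply: (@le_lt_trans _ _ (C / (1 - q))%:E); last exact: ltry.
  apply: lime_le; first exact: is_cvg_nneseries.
  apply: nearW => n.
  apply: (@le_trans _ _ (\sum_(0 <= N < n) (C * q ^+ N)%:E)%E).
    by apply: lee_sum => N _; rewrite prE// lee_fin.
  rewrite sumEFin lee_fin; apply: geometric_le_lim => //.
    exact: expR_ge0.
  by rewrite ger0_norm// ltW.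
have lim0 := lim_sup_set_cvg0 mA sumA.
exists (lim_sup_set A); split => //.
  by apply: bigcap_measurable => // k _; apply: bigcup_measurable.
move=> t /= tA k _ /=; apply: contrapT => nA; apply: tA; exists k => // N /= kN AN'.
by apply: nA; exists N.
Qed.

(** Deviations have exponentially small probability, hence are summable: only the law of each single
    [S N] enters, whatever the dependence between different [N]. *)
Lemma array_lln (S : nat -> T -> R) (c : nat -> nat) (rho xi : R) :
  0 < rho -> 0 <= xi ->
  (forall N, measurable_fun setT (S N)) -> (forall N t, 0 <= S N t) ->
  (forall N x, 0 <= x -> pr (gt_set (S N) x) =
    expR (- (rho * x)) * exp_sum (c N) (rho * x)) ->
  N%:R^-1 * (c N)%:R @[N --> \oo] --> xi ->
  {ae P, forall t, N%:R^-1 * S N t @[N --> \oo] --> xi / rho}.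
Proof.
move=> rho0 xi0 mS S0 SE cxi.
have near_c e : 0 < e -> exists N0 : nat, forall N, (N0 <= N)%N ->
    (0 < N)%N /\ (xi - e) * N%:R <= (c N)%:R <= (xi + e) * N%:R.
  move=> e0; have /cvgrPdist_le /(_ _ e0)[M _ MP] := cxi.
  exists (maxn M 1) => N; rewrite geq_max => /andP[MN N_gt0]; split => //.
  have N0 : (0 : R) < N%:R by rewrite ltr0n.
  have := MP N MN; rewrite ler_distl => /andP[].
  rewrite mulrC lerBlDr => c1 c2.
  by rewrite -ler_pdivlMr// lerBlDr c2 -ler_pdivrMr// c1.
have close l : {ae P, forall t, \forall N \near \oo,
    `|xi / rho - N%:R^-1 * S N t| <= l.+1%:R^-1}.
  pose e := l.+1%:R^-1 : R; have e0 : 0 < e by rewrite invr_gt0.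
  pose D := rho * e; have D0 : 0 < D by rewrite mulr_gt0.
  pose up N := gt_set (S N) ((xi / rho + e) * N%:R).
  pose lo N := [set t | S N t <= (xi / rho - e) * N%:R].
  have up_near : {ae P, forall t, \forall N \near \oo, ~ up N t}.
    have [kappa [eta [k0 eta0 kP]]] := chernoff_gt xi0 D0.
    have [N0 N0P] := near_c _ eta0.
    apply: (@borel_cantelli_expR up kappa N0) => // [N|N NN0].
      exact: measurable_gt_set.
    have [_ /andP[_ cN]] := N0P N NN0.
    rewrite SE; last by rewrite mulr_ge0// addr_ge0// ?divr_ge0//; exact: ltW.
    rewrite (_ : rho * _ = (xi + D) * N%:R); last by rewrite /D; field; rewrite gt_eqF.
    exact: kP.
  have mlo N : measurable (lo N).
    exact: measurable_set_le.
  have lo_near : {ae P, forall t, \forall N \near \oo, ~ lo N t}.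
    (* If [D > xi] the lower level is negative for [N >= 1], and nonnegativity of [S N] excludes the
       event. *)
    have [Dxi|xiD] := leP D xi; last first.
      apply: aeW => t; exists 1%N => // N /= N1 /= SN.
      have := S0 N t; rewrite leNgt => /negP; apply; apply: (le_lt_trans SN).
      rewrite pmulr_llt0 ?ltr0n// subr_lt0 ltr_pdivrMr// mulrC; exact: xiD.
    have [kappa [eta [k0 eta0 kP]]] := chernoff_le D0 Dxi.
    have [N0 N0P] := near_c _ eta0.
    apply: (@borel_cantelli_expR lo kappa N0) => // N NN0.
    have [N_gt0 /andP[cN _]] := N0P N NN0.
    have -> : lo N = setT `\` gt_set (S N) ((xi / rho - e) * N%:R).
      apply/seteqP; split => t; rewrite /lo /gt_set /setD /=.
        by move=> SN; split => //; apply/negP; rewrite -leNgt.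
      by move=> [_ /negP]; rewrite -leNgt.
    have mgt := measurable_gt_set ((xi / rho - e) * N%:R) (mS N).
    rewrite prD// pr_setT setTI SE; last first.
      by rewrite mulr_ge0// subr_ge0 ler_pdivlMr// mulrC.
    rewrite (_ : rho * _ = (xi - D) * N%:R); last by rewrite /D; field; rewrite gt_eqF.
    exact: kP.
  apply: filterS2 up_near lo_near => t upt lot; near=> N.
  have N_gt0 : (0 < N)%N by near: N; exists 1%N.
  have N0 : (0 : R) < N%:R by rewrite ltr0n.
  have uN : ~ up N t by near: N.
  have lN : ~ lo N t by near: N.
  rewrite distrC ler_distl; apply/andP; split.
    rewrite ler_pdivlMl// mulrC leNgt; apply/negP => /ltW; exact: lN.
  by rewrite ler_pdivrMl// mulrC leNgt; apply/negP; exact: uN.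
have := ae_foralln close; apply: filterS => t tP.
apply/cvgrPdist_le => e e0.
have [l le] : exists l : nat, l.+1%:R^-1 <= e.
  exists (Num.bound e^-1); rewrite -[leRHS]invrK lef_pV2 ?posrE ?invr_gt0//.
  rewrite ltW// (@lt_trans _ _ (Num.bound e^-1)%:R) ?ltr_nat//.
  by apply: archi_boundP; rewrite invr_ge0 ltW.
by have := tP l; apply: filterS => N /le_trans; exact.
Unshelve. all: by end_near. Qed.

End StrongLaw.

(** * Last-passage recursions *)

Section LastPassage.
Variable R : realType.
Implicit Types (w : nat -> nat -> R).

(** Greatest weight of an up-right path from the origin to [(i, j)], by recursion on the last step;
    a site on an axis is reached by a single path. The inner fixpoint climbs one column. *)
Fixpoint lpp w (i : nat) : nat -> R :=
  if i is i'.+1 then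
    (fix column j := if j is j'.+1 then
       w i'.+1 j'.+1 + Num.max (lpp w i' j'.+1) (column j')
     else lpp w i' 0%N + w i'.+1 0%N)
  else
    (fix column j := if j is j'.+1 then column j' + w 0%N j'.+1 else w 0%N 0%N).

Lemma lpp_horizontal w i : lpp w i.+1 0%N = lpp w i 0%N + w i.+1 0%N.
Proof. by []. Qed.

Lemma lpp_vertical w j : lpp w 0%N j.+1 = lpp w 0%N j + w 0%N j.+1.
Proof. by []. Qed.

Lemma lppSS w i j :
  lpp w i.+1 j.+1 = w i.+1 j.+1 + Num.max (lpp w i j.+1) (lpp w i.+1 j).
Proof. by []. Qed.

Lemma lpp_bottom w i : lpp w i 0%N = w 0%N 0%N + \sum_(1 <= k < i.+1) w k 0%N.
Proof.
elim: i => [|i IH]; first by rewrite big_geq// addr0.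
by rewrite lpp_horizontal IH [in RHS]big_nat_recr//= addrA.
Qed.

Lemma lpp_left w j : lpp w 0%N j = w 0%N 0%N + \sum_(1 <= k < j.+1) w 0%N k.
Proof.
elim: j => [|j IH]; first by rewrite big_geq// addr0.
by rewrite lpp_vertical IH [in RHS]big_nat_recr//= addrA.
Qed.

Lemma le_lpp w w' i j : (forall a b, w a b <= w' a b) -> lpp w i j <= lpp w' i j.
Proof.
move=> ww'; elim: i j => [|i IHi]; elim=> [|j IHj].
- exact: ww'.
- by rewrite !lpp_vertical lerD.
- by rewrite !lpp_horizontal lerD.
- by rewrite !lppSS lerD// ge_max !le_max IHi IHj orbT.
Qed.

(* [u] and [v] scale the weights of the horizontal and vertical axis; the
   origin carries no weight. *)
Definition boundary_coef (u v : R) (i j : nat) : R :=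
  match i, j with 0%N, 0%N => 0 | _.+1, 0%N => u | 0%N, _.+1 => v | _, _ => 1 end.

Definition boundary_lpp (u v : R) w := lpp (fun i j => boundary_coef u v i j * w i j).

Lemma boundary_lpp_bottom u v w i :
  boundary_lpp u v w i 0%N = u * \sum_(1 <= k < i.+1) w k 0%N.
Proof.
rewrite /boundary_lpp lpp_bottom /= mul0r add0r big_distrr/=.
by rewrite !big_nat; apply: eq_bigr => -[].
Qed.

Lemma boundary_lpp_left u v w j :
  boundary_lpp u v w 0%N j = v * \sum_(1 <= k < j.+1) w 0%N k.
Proof.
rewrite /boundary_lpp lpp_left /= mul0r add0r big_distrr/=.
by rewrite !big_nat; apply: eq_bigr => -[].
Qed.

Lemma le_boundary_lpp u v u' v' w i j : (forall a b, 0 <= w a b) ->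
  u <= u' -> v <= v' -> boundary_lpp u v w i j <= boundary_lpp u' v' w i j.
Proof.
by move=> w0 uu' vv'; apply: le_lpp => -[|a] [|b]; apply: ler_wpM2r.
Qed.

Lemma le_sum_axis (f : nat -> R) (i k : nat) : (forall a, 0 <= f a) -> (i <= k)%N ->
  \sum_(1 <= a < i.+1) f a <= \sum_(1 <= a < k.+1) f a.
Proof.
move=> f0 ik; rewrite [leRHS](@big_cat_nat _ _ _ i.+1)//=.
by rewrite lerDl; apply: sumr_ge0.
Qed.

(* A path follows one of the axes either for at most [k] steps, or for more
   than [k] steps; in the latter case it gains from a larger axis weight. *)
Lemma boundary_lpp_exit u v u' v' u'' v'' w k i j (A B : R) :
  (forall a b, 0 <= w a b) ->
  0 <= u -> u <= u' -> 0 <= v'' -> 0 <= v -> v <= v' -> 0 <= u'' ->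
  A = \sum_(1 <= a < k.+1) w a 0%N -> B = \sum_(1 <= b < k.+1) w 0%N b ->
  boundary_lpp u v w i j <= Num.max (boundary_lpp 0 0 w i j + (u * A + v * B))
    (Num.max (boundary_lpp u' v'' w i j - (u' - u) * A)
             (boundary_lpp u'' v' w i j - (v' - v) * B)).
Proof.
move=> w0 u0 uu' v''0 v0 vv' u''0 AE BE.
have A0 : 0 <= A by rewrite AE sumr_ge0.
have B0 : 0 <= B by rewrite BE sumr_ge0.
have max3 x a1 a2 a3 : (x <= Num.max a1 (Num.max a2 a3 : R)) =
  [|| x <= a1, x <= a2 | x <= a3] by rewrite !le_max.
elim: i j => [|i IHi].
  move=> j; rewrite !boundary_lpp_left mul0r add0r max3.
  (* A path to this site spends all its [j] steps on the vertical axis: at most [k] steps give the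
     first alternative, more give the third. *)
  have [jk|/ltnW kj] := leqP j k.
    apply/orP; left; apply: ler_wpDl; first exact: mulr_ge0.
    by rewrite ler_wpM2l// ?AE ?BE le_sum_axis.
  apply/orP; right; apply/orP; right.
  have := @le_sum_axis (fun b => w 0%N b) _ _ (w0 _) kj; rewrite -BE => Bj.
  by have := ler_wpM2l (_ : 0 <= v' - v) Bj; rewrite subr_ge0 => /(_ vv'); lra.
elim=> [|j IHj].
  rewrite !boundary_lpp_bottom mul0r add0r max3.
  have [ik|/ltnW ki] := leqP i.+1 k.
    apply/orP; left; apply: ler_wpDr; first exact: mulr_ge0.
    by rewrite ler_wpM2l// ?AE ?BE le_sum_axis.
  apply/orP; right; apply/orP; left.
  have := @le_sum_axis (fun a => w a 0%N) _ _ (w0^~ _) ki; rewrite -AE => Ai.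
  by have := ler_wpM2l (_ : 0 <= u' - u) Ai; rewrite subr_ge0 => /(_ uu'); lra.
have ge_l (x y : R) : x <= Num.max x y by rewrite le_max lexx.
have ge_r (x y : R) : y <= Num.max x y by rewrite le_max lexx orbT.
(* Off the axes the weights do not depend on the boundary parameters, so the alternative that holds
   at the better predecessor survives the addition of [w i.+1 j.+1]. *)
pose N x y := boundary_lpp x y w.
have NS x y : N x y i.+1 j.+1 =
    w i.+1 j.+1 + Num.max (N x y i j.+1) (N x y i.+1 j).
  by rewrite /N /boundary_lpp lppSS /= mul1r.
have up x y : w i.+1 j.+1 + N x y i j.+1 <= N x y i.+1 j.+1.
  by rewrite NS lerD2l ge_l.
have right x y : w i.+1 j.+1 + N x y i.+1 j <= N x y i.+1 j.+1.
  by rewrite NS lerD2l ge_r.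
rewrite -/(N _ _) -/(N 0 0) -/(N u' _) -/(N u'' _) NS.
have := IHi j.+1; move: IHj; rewrite -!/(N _ _) !max3.
have [_ + _|_ _] := leP (N u v i j.+1) (N u v i.+1 j).
  by move=> /or3P[] le; apply/or3P; [apply: Or31|apply: Or32|apply: Or33];
    apply: le_trans (lerD (lexx _) le) _; rewrite addrA lerD2r right.
by move=> /or3P[] le; apply/or3P; [apply: Or31|apply: Or32|apply: Or33];
  apply: le_trans (lerD (lexx _) le) _; rewrite addrA lerD2r up.
Qed.
Lemma bulk_bottom w i : boundary_lpp 0 0 w i 0%N = 0.
Proof. by rewrite boundary_lpp_bottom mul0r. Qed.

Lemma bulk_left w j : boundary_lpp 0 0 w 0%N j = 0.
Proof. by rewrite boundary_lpp_left mul0r. Qed.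

Lemma bulkSS w i j : boundary_lpp 0 0 w i.+1 j.+1 =
  w i.+1 j.+1 + Num.max (boundary_lpp 0 0 w i j.+1) (boundary_lpp 0 0 w i.+1 j).
Proof. by rewrite /boundary_lpp lppSS /= mul1r. Qed.

Lemma bulk_ge0 w i j : (forall a b, 0 <= w a b) ->
  0 <= boundary_lpp 0 0 w i j.
Proof.
move=> v0; elim: i j => [|i IH] [|j]; rewrite ?bulk_left ?bulk_bottom//.
by rewrite bulkSS addr_ge0// le_max IH.
Qed.

Lemma lpp_vertical_incr w i j : (forall a b, 0 <= w a b) ->
  lpp w i 0%N <= lpp w i j.
Proof.
move=> w0; elim: j => [//|j IH]; apply: (le_trans IH).
case: i {IH} => [|i]; first by rewrite lpp_vertical lerDl.
by rewrite lppSS ler_wpDl// le_max lexx orbT.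
Qed.

(** The path straight up the first bulk column has this weight. With its mirror image below, it
    settles directions along an axis. *)
Lemma bulk_column_le w m n : (forall a b, 0 <= w a b) ->
  \sum_(0 <= j < n) w 1%N j.+1 <= boundary_lpp 0 0 w m.+1 n.
Proof.
move=> w0; elim: m n => [|m IHm].
  elim=> [|n IHn]; first by rewrite big_geq// bulk_bottom.
  by rewrite bulkSS big_nat_recr//= addrC lerD2l le_max IHn orbT.
move=> [|n]; first by rewrite big_geq// bulk_bottom.
by rewrite bulkSS; apply: ler_wpDl => //; rewrite le_max IHm.
Qed.

Lemma bulk_row_le w m n : (forall a b, 0 <= w a b) ->
  \sum_(0 <= i < m) w i.+1 1%N <= boundary_lpp 0 0 w m n.+1.
Proof.
move=> w0; elim: n m => [|n IHn].
  elim=> [|m IHm]; first by rewrite big_geq// bulk_left.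
  by rewrite bulkSS big_nat_recr//= addrC lerD2l le_max IHm.
move=> [|m]; first by rewrite big_geq// bulk_left.
by rewrite bulkSS; apply: ler_wpDl => //; rewrite le_max IHn orbT.
Qed.

End LastPassage.

(** * The stationary model *)

Section Stationary.
Context (R : realType) (d : measure_display) (T : measurableType d).
Variable P : probability T R.
Local Notation pr := (pr P).
Local Notation site := (nat * nat)%type.

Section Increments.
Variables (X : site -> T -> R) (s : seq site) (m n : nat) (al be : R).
Hypotheses (al0 : 0 < al) (be0 : 0 < be).
Let r (p : site) : R :=
  if p.2 == 0%N then al else if p.1 == 0%N then be else al + be.
Hypotheses (us : uniq s) (eX : exp_tails P s X r).
Hypothesis s_rect : forall i j, (i <= m)%N -> (j <= n)%N -> (i + j != 0)%N ->
  (i, j) \in s.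

Let L t := lpp (fun i j => X (i, j) t).

(** Sweeps the columns from left to right: the slots [(0, j.+1)] hold the vertical increments along
    the current column [i], and the slots to its right still hold the original weights. *)
Let exp_tails_column i : (i <= m)%N -> exists Z, [/\ exp_tails P s Z r,
  forall j, (j < n)%N -> Z (0%N, j.+1) = fun t => L t i j.+1 - L t i j,
  forall a, (i < a)%N -> Z (a, 0%N) = X (a, 0%N) &
  forall a b, (i < a)%N -> Z (a, b.+1) = X (a, b.+1)].
Proof.
elim: i => [_|i IH im].
  exists X; split => // j jn; apply/funext => t.
  by rewrite /L lpp_vertical addrAC subrr add0r.
have [Z [eZ Z0 Za Zb]] := IH (ltnW im).
(* Within a column the sweep climbs cell by cell. Below height [j] the vertical increments are
   already those of column [i.+1], from [j] on still those of column [i], and [(i.+1, 0)] carries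
   the horizontal increment at height [j]. *)
suff cells j : (j <= n)%N -> exists Y, [/\ exp_tails P s Y r,
    forall b, (b < j)%N -> Y (0%N, b.+1) = fun t => L t i.+1 b.+1 - L t i.+1 b,
    forall b, (j <= b < n)%N -> Y (0%N, b.+1) = fun t => L t i b.+1 - L t i b,
    Y (i.+1, 0%N) = (fun t => L t i.+1 j - L t i j) /\
      (forall a, (i.+1 < a)%N -> Y (a, 0%N) = X (a, 0%N)) &
    (forall b, (j <= b)%N -> Y (i.+1, b.+1) = X (i.+1, b.+1)) /\
      (forall a b, (i.+1 < a)%N -> Y (a, b.+1) = X (a, b.+1))].
  have [Y [eY Y0 _ [_ Ya] [_ Yb]]] := cells n (leqnn n).
  by exists Y; split.
elim: j => [_|j IHj jn].
  exists Z; split => //; last by split => [b _|a b /ltnW ia]; exact: Zb.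
  split; last by move=> a /ltnW; exact: Za.
  by rewrite Za//; apply/funext => t; rewrite /L lpp_horizontal addrAC subrr add0r.
have [Y [eY Y0 Y1 [Y2 Ya] [Yb Yc]]] := IHj (ltnW jn).
exists (burke_step (i.+1, 0%N) (0%N, j.+1) (i.+1, j.+1) Y).
have burkeE A B C (t : T) : A = (fun t => L t i.+1 j - L t i j) ->
    B = (fun t => L t i j.+1 - L t i j) -> C = X (i.+1, j.+1) ->
    burke_in A B C t = L t i.+1 j.+1 - L t i j.+1 /\
    burke_in B A C t = L t i.+1 j.+1 - L t i.+1 j.
  move=> -> -> ->; rewrite /burke_in /L lppSS -/(L t).
  set w := X _ t; set a := L t i j.+1; set b := L t i.+1 j; set c := L t i j.
  by split; case: (leP a b); [case: (leP (b - c - (a - c)) 0)|case: (leP (b - c - (a - c)) 0)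
    |case: (leP (a - c - (b - c)) 0)|case: (leP (a - c - (b - c)) 0)]; lra.
have Y1j : Y (0%N, j.+1) = fun t => L t i j.+1 - L t i j by rewrite Y1// leqnn.
have Ybj := Yb j (leqnn j).
split.
- by apply: exp_tails_burke; rewrite ?xpair_eqE ?andbF ?eqxx//; exact: s_rect.
- move=> b; rewrite ltnS leq_eqVlt => /orP[/eqP ->|bj].
    rewrite /burke_step /= !xpair_eqE /= !eqxx; apply/funext => t.
    by have [_ ->] := burkeE _ _ _ t Y2 Y1j Ybj.
  by rewrite /burke_step /= !xpair_eqE /= eqSS ltn_eqF// Y0.
- move=> b /andP[jb bn]; rewrite /burke_step /= !xpair_eqE /= eqSS gtn_eqF//.
  by rewrite Y1// (ltnW jb).
- split.
    rewrite /burke_step eqxx; apply/funext => t.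
    by have [-> _] := burkeE _ _ _ t Y2 Y1j Ybj.
  move=> a ia; rewrite /burke_step /= !xpair_eqE /= andbT andbF gtn_eqF//=; exact: Ya.
- split.
    move=> b jb; rewrite /burke_step /= !xpair_eqE /= andbF eqxx eqSS gtn_eqF//.
    by rewrite Yb// ltnW.
  move=> a b ia; rewrite /burke_step /= !xpair_eqE /= !andbF (gtn_eqF ia)
    (gtn_eqF (ltn_trans _ ia))//=.
  exact: Yc.
Qed.

(** The vertical increments along column [m] telescope, and after the sweep they are [n] independent
    variables of rate [be]. *)
Lemma pr_lpp_increment_gt x : 0 <= x ->
  pr [set t | x < L t m n - L t m 0%N] =
  expR (- (be * x)) * exp_sum n (be * x).
Proof.
move=> x0; have [Z [eZ Z0 _ _]] := exp_tails_column (leqnn m).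
pose s1 := [seq (0%N, j.+1) | j <- iota 0 n] : seq site.
have us1 : uniq s1 by rewrite map_inj_uniq ?iota_uniq// => i j [].
have s1s : {subset s1 <= s}.
  by move=> p /mapP[j]; rewrite mem_iota => /andP[_ jn] ->; exact: s_rect.
have eZ1 := exp_tails_sub us us1 s1s eZ.
have -> : [set t | x < L t m n - L t m 0%N] =
    [set t | x < \sum_(p <- s1) Z p t].
  apply/funext => t /=; congr (_ < _); rewrite /s1 big_map.
  rewrite (_ : iota 0 n = index_iota 0 n); last by rewrite /index_iota subn0.
  by rewrite -telescope_sumr// !big_nat; apply: eq_bigr => j /andP[_ jn]; rewrite Z0.
rewrite (pr_sum_gt1 us1 eZ1 be0)//; first by rewrite size_map size_iota.
by move=> p /mapP[j _ ->].
Qed.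

End Increments.
End Stationary.

(** * Up-right paths *)

Section PassageTime.
Variables (R : realType) (w : Z2 -> R).
Hypothesis w_ge0 : forall z, 0 <= w z.

(* Shifting by one keeps the bulk away from the axes, which carry the boundary
   weights. *)
Definition shifted_weight (i j : nat) : R := w (i%:Z - 1, j%:Z - 1).

Local Notation G := (boundary_lpp 0 0 shifted_weight).

Lemma shifted_weightSS i j : shifted_weight i.+1 j.+1 = w (i%:Z, j%:Z).
Proof. by rewrite /shifted_weight !intS ![1 + _]addrC !addrK. Qed.

Let GSS i j : G i.+1 j.+1 = w (i%:Z, j%:Z) + Num.max (G i j.+1) (G i.+1 j).
Proof. by rewrite bulkSS shifted_weightSS. Qed.

Let G_ge0 i j : 0 <= G i j.
Proof. by apply: bulk_ge0 => a b; exact: w_ge0. Qed.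

Let path_sum_le (N : nat) (p : nat -> Z2) : p 0%N = 0 ->
  (forall k, (k < N)%N -> p k.+1 - p k = e1 \/ p k.+1 - p k = e2) ->
  forall k, (k <= N)%N -> exists a b : nat, p k = (a%:Z, b%:Z) /\
    \sum_(0 <= i < k.+1) w (p i) <= G a.+1 b.+1.
Proof.
move=> p0 st; elim=> [_|k IH kN].
  exists 0%N, 0%N; split; first by rewrite p0.
  by rewrite big_nat1 p0 GSS bulk_left bulk_bottom maxxx addr0.
have [a [b [pk le_k]]] := IH (ltnW kN).
case: (st k kN) => /eqP; rewrite subr_eq pk => /eqP pS.
  exists a.+1, b; split; first by rewrite pS intS /e1; congr pair; rewrite /= add0r.
  rewrite big_nat_recr//= pS GSS addrC [_ + (_, _)](_ : _ = (a.+1%:Z, b%:Z)); last first.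
    by rewrite intS /e1; congr pair; rewrite /= add0r.
  by rewrite lerD2l le_max le_k.
exists a, b.+1; split; first by rewrite pS intS /e2; congr pair; rewrite /= add0r.
rewrite big_nat_recr//= pS GSS addrC [_ + (_, _)](_ : _ = (a%:Z, b.+1%:Z)); last first.
  by rewrite intS /e2; congr pair; rewrite /= add0r.
by rewrite lerD2l le_max le_k orbT.
Qed.

(** Serves to show that the recursion is attained by a path. As [p] is a total function, a path is
    extended by redefining it beyond [N]. *)
Let reach (N : nat) (z : Z2) (g : R) := exists p : nat -> Z2,
  [/\ p 0%N = 0, p N = z,
    forall k, (k < N)%N -> p k.+1 - p k = e1 \/ p k.+1 - p k = e2 &
    g <= \sum_(0 <= k < N.+1) w (p k)].

Let reach_step N z e g : e = e1 \/ e = e2 -> reach N z g ->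
  reach N.+1 (e + z) (w (e + z) + g).
Proof.
move=> eE [p [p0 pN st gp]].
exists (fun k => if (k <= N)%N then p k else e + z); split => //.
- by rewrite ltnn.
- move=> k; move/[dup]; rewrite {1}ltnS {1}leq_eqVlt => /orP[/eqP ->|kN] _.
    by rewrite /= leqnn ltnn pN addrK; exact: eE.
  by rewrite /= kN (ltnW kN); exact: st.
rewrite big_nat_recr//= ltnn [leRHS]addrC lerD2l (le_trans gp)// le_eqVlt; apply/orP; left.
by apply/eqP; rewrite !big_nat; apply: eq_bigr => k /andP[_]; rewrite ltnS => ->.
Qed.

Let reach_bulk N a b : (a + b)%N = N -> reach N (a%:Z, b%:Z) (G a.+1 b.+1).
Proof.
elim: N a b => [|N IH] a b.
  move=> /eqP; rewrite addn_eq0 => /andP[/eqP -> /eqP ->].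
  exists (fun=> 0); split => //.
  by rewrite big_nat1 GSS bulk_left bulk_bottom maxxx addr0.
have right a' : (a' + b)%N = N ->
    reach N.+1 (a'.+1%:Z, b%:Z) (w (a'.+1%:Z, b%:Z) + G a'.+1 b.+1).
  move=> /IH /(reach_step (or_introl erefl)).
  rewrite [e1 + _](_ : _ = (a'.+1%:Z, b%:Z)) => [//|].
  by rewrite intS /e1; congr pair; rewrite /= add0r.
have up b' : (a + b')%N = N ->
    reach N.+1 (a%:Z, b'.+1%:Z) (w (a%:Z, b'.+1%:Z) + G a.+1 b'.+1).
  move=> /IH /(reach_step (or_intror erefl)).
  rewrite [e2 + _](_ : _ = (a%:Z, b'.+1%:Z)) => [//|].
  by rewrite intS /e2; congr pair; rewrite /= add0r.
case: a b right up => [|a] [|b] right up //.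
(* At the edge of the bulk one predecessor lies on an axis, where the recursion has value [0], so
   the maximum selects the other one. *)
- move=> abN; have := up b (succn_inj abN); rewrite (GSS 0%N b.+1) bulk_left.
  by rewrite max_r.
- rewrite addn0 => abN; have := right a; rewrite addn0 => /(_ (succn_inj abN)).
  by rewrite (GSS a.+1 0%N) bulk_bottom max_l.
move=> abN; rewrite GSS; have [_|_] := leP (G a.+1 b.+2) (G a.+2 b.+1).
  by apply: up; move: abN; rewrite addnS => -[].
by apply: right; move: abN; rewrite addSn => -[].
Qed.

Lemma passage_time_bulk (m n : nat) :
  passage_time w 0 (m%:Z, n%:Z) = G m.+1 n.+1.
Proof.
have norm : l1norm ((m%:Z, n%:Z) - 0)%R = (m + n)%N by rewrite subr0.
have le0 : le_Z2 0 (m%:Z, n%:Z) by split.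
have [[p [p0 pN st] ->] le_pt] := passage_time_max w le0.
apply/eqP; rewrite eq_le; apply/andP; split.
  move: pN st; rewrite /path_weight norm => pN st.
  have [a [b []]] := path_sum_le p0 st (leqnn _).
  by rewrite pN => -[<- <-].
have [q [q0 qN stq]] := reach_bulk (erefl (m + n)%N).
move=> /le_trans; apply; have := le_pt q; rewrite /path_weight /up_right_path norm.
exact.
Qed.

End PassageTime.

(** * The limit *)

Lemma exponential_prob_gt (R : realType) (x : R) : 0 <= x ->
  exponential_prob 1 `]x, +oo[%classic = (expR (- x))%:E.
Proof.
move=> x0; have m_pdf := measurable_exponential_pdf (1 : R).
rewrite /exponential_prob integral_itv_obnd_cbnd; last first.
  by apply/measurable_EFinP; exact: measurable_funTS.
have cexp : continuous (fun z : R => expR (- 1 * z)).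
  move=> z; apply: continuous_comp; last exact: continuous_expR.
  by apply: continuousM => //; exact: cst_continuous.
rewrite (@ge0_continuous_FTC2y _ _ (fun z => - (expR (- 1 * z))) _ 0)//.
- by rewrite mulN1r sub0e EFinN oppeK.
- by move=> z _; exact: exponential_pdf_ge0.
- apply: (@continuous_subspaceW R^o _ _ [set` `[0, +oo[%R]).
    by apply: subset_itvr; rewrite bnd_simp.
  exact: within_continuous_exponential_pdf.
- rewrite -oppr0; apply: cvgN.
  rewrite (_ : (fun z => _) = (fun z => expR (- z))); first exact: cvgr_expR.
  by apply/funext => z; rewrite mulN1r.
- by apply: cvgN; apply/cvg_at_right_filter; exact: cexp.
- move=> z; rewrite in_itv/= andbT => xz; apply: derive1_exponential_pdf.
  by rewrite in_itv/= andbT (le_lt_trans x0).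
Qed.

(** * The given weights as boundary and bulk weights of the stationary models *)

Section Environment.
Context (R : realType) (d : measure_display) (T : measurableType d).
Variables (P : probability T R) (omega : Z2 -> {RV P >-> R}).
Hypothesis omega_indep : mutually_independent omega.
Hypothesis omega_exp : forall x : Z2, exponentially_distributed 1 (omega x).
Local Notation pr := (pr P).
Local Notation site := (nat * nat)%type.

(* The truncation makes the weights nonnegative everywhere; it changes [omega]
   only on a null set. *)
Definition env (p : site) (t : T) : R :=
  Num.max (omega (p.1%:Z - 1, p.2%:Z - 1) t) 0.

Lemma exp_tails_env (s : seq site) : uniq s -> exp_tails P s env (fun=> 1).
Proof.
move=> us; split.
- by move=> p; apply: measurable_maxr => //; exact: measurable_funP.
- by move=> p t; rewrite /env le_max lexx orbT.
move=> u u0; pose to_Z2 (p : site) : Z2 := (p.1%:Z - 1, p.2%:Z - 1).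
have to_Z2_inj : injective to_Z2.
  by move=> [a b] [a' b'] [/addIr[->] /addIr[->]].
(* A left inverse of the shift, which indexes the levels by [Z2] as the independence hypothesis
   requires. *)
pose of_Z2 (z : Z2) : site := (absz (z.1 + 1), absz (z.2 + 1)).
have of_Z2K p : of_Z2 (to_Z2 p) = p.
  by rewrite /of_Z2 /to_Z2 /= !subrK; case: p.
have := omega_indep (s := map to_Z2 s) (A := fun z => `]u (of_Z2 z), +oo[%classic).
rewrite map_inj_uniq// => /(_ us (fun _ _ => measurable_itv _)).
rewrite big_map => indep; apply: EFin_inj.
rewrite -prE; last by apply: measurable_tails => p;
  apply: measurable_maxr => //; exact: measurable_funP.
have -> : tails s env u =
    \bigcap_(i in [set` map to_Z2 s]) (omega i @^-1` `]u (of_Z2 i), +oo[%classic).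
  apply/seteqP; split => t; rewrite /tails /=.
    move=> /allP su _ /= /mapP[p sp ->]; rewrite of_Z2K in_itv/= andbT.
    (* The levels are nonnegative, so truncating the weights at [0] leaves the event unchanged. *)
    by have := su p sp; rewrite /env lt_max (ltNge _ 0) u0 orbF.
  move=> su; apply/allP => p sp; rewrite /env lt_max; apply/orP; left.
  have := su (to_Z2 p) (map_f _ sp).
  by rewrite /= of_Z2K in_itv/= andbT.
rewrite indep -prodEFin; apply: eq_bigr => p _; rewrite of_Z2K mul1r.
by rewrite -exponential_prob_gt// -(@omega_exp (to_Z2 p) _ (measurable_itv _)).
Qed.

Lemma env_ge0 p t : 0 <= env p t.
Proof. by rewrite /env le_max lexx orbT. Qed.

Lemma measurable_env p : measurable_fun setT (env p).
Proof. by apply: measurable_maxr => //; exact: measurable_funP. Qed.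

Lemma env_lln (f : nat -> site) (c : nat -> nat) (kap : R) : injective f ->
  0 <= kap -> N%:R^-1 * (c N)%:R @[N --> \oo] --> kap ->
  {ae P, forall t, N%:R^-1 * (\sum_(0 <= i < c N) env (f i) t) @[N --> \oo] --> kap}.
Proof.
move=> f_inj kap0 ckap.
have := @array_lln _ _ _ P (fun N t => \sum_(0 <= i < c N) env (f i) t) c 1 kap ltr01 kap0.
rewrite divr1; apply => //.
- by move=> N; apply: measurable_sum => i; exact: measurable_env.
- by move=> N t; apply: sumr_ge0 => i _; exact: env_ge0.
move=> N x x0; pose s := map f (iota 0 (c N)).
have us : uniq s by rewrite map_inj_uniq ?iota_uniq.
have := pr_sum_gt1 us (exp_tails_env us) ltr01 (fun _ _ => erefl) x0.
rewrite size_map size_iota => <-; congr pr; apply/funext => t /=.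
by rewrite /gt_set /= /s big_map /index_iota subn0.
Qed.

Local Notation w t := (fun i j : nat => env (i, j) t).

(** A rate 1 variable divided by a rate acquires that rate, and [al + be = 1] leaves the bulk
    unscaled. The origin is excluded since its coefficient is [0]. *)
Lemma exp_tails_boundary (s : seq site) (al be : R) : uniq s ->
  (0%N, 0%N) \notin s -> 0 < al -> 0 < be -> al + be = 1 ->
  exp_tails P s (fun p t => boundary_coef al^-1 be^-1 p.1 p.2 * env p t)
    (fun p => if p.2 == 0%N then al else if p.1 == 0%N then be else al + be).
Proof.
move=> us s00 al0 be0 albe; pose r (p : site) := if p.2 == 0%N then al
  else if p.1 == 0%N then be else al + be.
have r0 p : 0 < r p by rewrite /r; do 2?[case: ifP => // _]; rewrite addr_gt0.
have coefE p : p \in s -> boundary_coef al^-1 be^-1 p.1 p.2 = (r p)^-1.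
  case: p => -[|i] [|j] ps; rewrite /r//=; last by rewrite albe invr1.
  by move: s00; rewrite ps.
have [mE E0 EE] := exp_tails_env us.
split.
- by move=> p; exact: measurable_funM.
- move=> p t; apply: mulr_ge0 => //.
  by case: p => -[|i] [|j] //=; rewrite invr_ge0 ltW.
move=> u u0; have -> : tails s
    (fun p t => boundary_coef al^-1 be^-1 p.1 p.2 * env p t) u =
    tails s env (fun p => r p * u p).
  apply/funext => t; rewrite /tails /=; congr is_true; apply: eq_in_all => p ps.
  by rewrite coefE// [_^-1 * _]mulrC ltr_pdivlMr// mulrC.
rewrite EE; first by apply: eq_bigr => p _; rewrite mul1r.
by move=> p; rewrite mulr_ge0// ltW.
Qed.

Lemma measurable_lpp (X : site -> T -> R) i j :
  (forall p, measurable_fun setT (X p)) ->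
  measurable_fun setT (fun t => lpp (fun a b => X (a, b) t) i j).
Proof.
move=> mX; elim: i j => [|i IHi]; elim=> [|j IHj].
- exact: mX.
- exact: measurable_funD.
- exact: measurable_funD.
- apply: measurable_funD => //; exact: measurable_maxr.
Qed.

Definition rectangle (m n : nat) : seq site :=
  [seq p <- [seq (i, j) | i <- iota 0 m.+1, j <- iota 0 n.+1] | p != (0%N, 0%N)].

Lemma rectangle_uniq m n : uniq (rectangle m n).
Proof. by rewrite filter_uniq// allpairs_uniq ?iota_uniq// => -[? ?] [? ?]. Qed.

Lemma mem_rectangle m n i j : (i <= m)%N -> (j <= n)%N -> (i + j != 0)%N ->
  (i, j) \in rectangle m n.
Proof.
move=> im jn ij; rewrite mem_filter; apply/andP; split.
  by apply: contraNN ij => /eqP[-> ->].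
by apply: allpairs_f; rewrite mem_iota.
Qed.

Lemma origin_rectangle m n : (0%N, 0%N) \notin rectangle m n.
Proof. by rewrite mem_filter eqxx. Qed.

(** The last-passage time is the sum along the horizontal axis plus the vertical increment in column
    [m N]. Each part obeys a strong law, and almost sure limits add however the parts are
    correlated. *)
Lemma stationary_lln (al be x1 x2 : R) (m n : nat -> nat) :
  0 < al -> 0 < be -> al + be = 1 -> 0 <= x1 -> 0 <= x2 ->
  N%:R^-1 * (m N)%:R @[N --> \oo] --> x1 ->
  N%:R^-1 * (n N)%:R @[N --> \oo] --> x2 ->
  {ae P, forall t, N%:R^-1 * boundary_lpp al^-1 be^-1 (w t) (m N) (n N)
    @[N --> \oo] --> x1 / al + x2 / be}.
Proof.
move=> al0 be0 albe x10 x20 mx1 nx2.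
pose X (p : site) t := boundary_coef al^-1 be^-1 p.1 p.2 * env p t.
have eX N := exp_tails_boundary (rectangle_uniq (m N) (n N))
  (origin_rectangle (m N) (n N)) al0 be0 albe.
have mX p : measurable_fun setT (X p) by have [mX _ _] := eX 0%N; exact: mX.
have X0 p t : 0 <= X p t by have [_ X0 _] := eX 0%N; exact: X0.
pose L t := lpp (fun i j => X (i, j) t).
have mL i j : measurable_fun setT (fun t => L t i j) by exact: measurable_lpp.
have vertical := array_lln (S := fun N t => L t (m N) (n N) - L t (m N) 0%N)
  be0 x20 _ _ _ nx2.
have {}vertical : {ae P, forall t,
    N%:R^-1 * (L t (m N) (n N) - L t (m N) 0%N) @[N --> \oo] --> x2 / be}.
  apply: vertical => [N|N t|N x].
  - exact: measurable_funB.
  - by rewrite subr_ge0; apply: lpp_vertical_incr => a b; exact: X0.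
  exact: (pr_lpp_increment_gt al0 be0 (rectangle_uniq _ _) (eX N) (@mem_rectangle _ _)).
have S_inj : injective (fun i => (i.+1, 0%N) : site) by move=> i j [].
have := env_lln S_inj x10 mx1.
apply: filterS2 vertical => t vt ht.
rewrite [X in X @ _ --> _](_ : _ = fun N => al^-1 *
    (N%:R^-1 * \sum_(0 <= i < m N) env (i.+1, 0%N) t) +
    N%:R^-1 * (L t (m N) (n N) - L t (m N) 0%N)).
  apply: cvgD => //; rewrite [x1 / al]mulrC; exact: cvgMr.
have LE i j : L t i j = boundary_lpp al^-1 be^-1 (w t) i j by [].
apply/funext => N; rewrite !LE boundary_lpp_bottom big_add1 /=; ring.
Qed.

End Environment.

(** * Integer endpoints *)

Section ScaledFloor.
Variable R : realType.

(** The successor matches the shift of the bulk by one and keeps endpoints off the axes. *)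
Definition side (x : R) (N : nat) : nat := (absz (Num.floor (N%:R * x))).+1.

Lemma side_cvg (x : R) : 0 <= x -> N%:R^-1 * (side x N)%:R @[N --> \oo] --> x.
Proof.
move=> x0; apply/cvgrPdist_le => e e0.
exists (Num.bound e^-1).+1 => // N /= eN.
have N0 : (0 : R) < N%:R by rewrite ltr0n (leq_trans _ eN).
have Nx : 0 <= N%:R * x by rewrite mulr_ge0// ltW.
have floorE : (absz (Num.floor (N%:R * x)))%:R = (Num.floor (N%:R * x))%:~R :> R.
  by rewrite -[LHS]/((absz _)%:Z%:~R) gez0_abs// floor_ge0.
have f1 := floor_le_tmp (N%:R * x); have f2 := floorD1_gt (N%:R * x).
have -> : x - N%:R^-1 * (side x N)%:R = N%:R^-1 * (N%:R * x - (side x N)%:R).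
  by field; rewrite gt_eqF.
rewrite normrM ger0_norm ?invr_ge0 ?(ltW N0)// ler_pdivrMl//.
apply: (@le_trans _ _ 1).
  rewrite /side -natr1 floorE ler_norml.
  by move: f2; rewrite intrD => f2; apply/andP; split; lra.
rewrite -ler_pdivrMr// mul1r ltW// (@lt_le_trans _ _ (Num.bound e^-1)%:R)//.
  by apply: archi_boundP; rewrite invr_ge0 ltW.
by rewrite ler_nat ltnW.
Qed.

End ScaledFloor.

(* The perturbation of the density costs a term of second order in [h], while
   the axis gains a term of first order. *)
Lemma perturbed_density_lt (R : realType) (s al be h e : R) :
  0 < h -> h < al -> 0 < be -> al + be = 1 -> 0 < e ->
  s ^+ 2 * al * h <= e * be ->
  (al * s) ^+ 2 / (al - h) + (be * s) ^+ 2 / (be + h) -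
    ((al - h)^-1 - al^-1) * e < s ^+ 2.
Proof.
move=> h0 hal be0 albe e0 hbe; have beE : be = 1 - al by lra.
have al0 : 0 < al by lra.
have -> : (al * s) ^+ 2 / (al - h) + (be * s) ^+ 2 / (be + h) -
    ((al - h)^-1 - al^-1) * e =
    s ^+ 2 + h / (al * (al - h) * (be + h)) * (s ^+ 2 * al * h - e * (be + h)).
  by rewrite beE; field; apply/and3P; split; lra.
rewrite -ltrBrDl subrr pmulr_rlt0.
  have : 0 < e * h by rewrite mulr_gt0.
  by rewrite mulrDr; lra.
by rewrite divr_gt0// !mulr_gt0//; lra.
Qed.

(** * Upper and lower bounds for the bulk last-passage time *)

Section Limit.
Context (R : realType) (d : measure_display) (T : measurableType d).
Variables (P : probability T R) (omega : Z2 -> {RV P >-> R}).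
Hypothesis omega_indep : mutually_independent omega.
Hypothesis omega_exp : forall x : Z2, exponentially_distributed 1 (omega x).
Local Notation w t := (fun i j : nat => env omega (i, j) t).
Local Notation stationary_lln := (stationary_lln omega_indep omega_exp).
Local Notation env_lln := (env_lln omega_indep omega_exp).

Variables (x1 x2 : R) (m n : nat -> nat).
Hypotheses (x1_ge0 : 0 <= x1) (x2_ge0 : 0 <= x2).
Hypothesis mx1 : N%:R^-1 * (m N)%:R @[N --> \oo] --> x1.
Hypothesis nx2 : N%:R^-1 * (n N)%:R @[N --> \oo] --> x2.

Let w_ge0 t a b : 0 <= w t a b. Proof. exact: env_ge0. Qed.

Lemma bulk_upper (e : R) : 0 < e -> {ae P, forall t, \forall N \near \oo,
  N%:R^-1 * boundary_lpp 0 0 (w t) (m N) (n N) <=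
  (Num.sqrt x1 + Num.sqrt x2) ^+ 2 + e}.
Proof.
move=> e0; set a := Num.sqrt x1; set b := Num.sqrt x2.
have a0 : 0 <= a by exact: sqrtr_ge0.
have b0 : 0 <= b by exact: sqrtr_ge0.
have x1E : x1 = a ^+ 2 by rewrite sqr_sqrtr.
have x2E : x2 = b ^+ 2 by rewrite sqr_sqrtr.
(* The optimal density [a / (a + b)] degenerates when [a] or [b] vanishes, so both are raised by
   [dl]. The limit is then at most [(a + b) * (a + b + 2 * dl)], which for this [dl] is below
   [(a + b) ^+ 2 + e]. *)
pose dl := e / (2 * (a + b + 1)).
have dl0 : 0 < dl by rewrite divr_gt0// mulr_gt0//; lra.
have dlE : 2 * dl * (a + b + 1) = e by rewrite /dl; field; lra.
pose s := a + b + 2 * dl.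
have s0 : 0 < s by rewrite /s; lra.
have al0 : 0 < (a + dl) / s by rewrite divr_gt0//; lra.
have be0 : 0 < (b + dl) / s by rewrite divr_gt0//; lra.
have albe : (a + dl) / s + (b + dl) / s = 1 by rewrite /s; field; rewrite -/s; lra.
have lt_e : x1 / ((a + dl) / s) + x2 / ((b + dl) / s) < (a + b) ^+ 2 + e.
  have q c : 0 <= c -> c ^+ 2 / ((c + dl) / s) <= c * s.
    move=> c0; rewrite invf_div mulrA ler_pdivrMr; last by lra.
    rewrite -subr_ge0 [leRHS](_ : _ = c * s * dl); last by ring.
    by rewrite mulr_ge0 ?(ltW dl0)// mulr_ge0 ?(ltW s0).
  have := q a a0; have := q b b0; rewrite -x1E -x2E => qb qa.
  apply: (@le_lt_trans _ _ ((a + b) * s)); first by lra.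
  by rewrite /s -dlE; lra.
have := stationary_lln al0 be0 albe x1_ge0 x2_ge0 mx1 nx2.
apply: filterS => t Lt; apply: filterS (cvgr_lt _ Lt _ lt_e) => N /ltW.
apply: le_trans; apply: ler_wpM2l; first by rewrite invr_ge0.
by apply: le_boundary_lpp => //; rewrite invr_ge0 ltW.
Qed.

(** When one coordinate vanishes the limit is the other coordinate, and a straight path already
    achieves it. *)
Lemma bulk_lower_axis (e : R) : (forall N, (0 < m N)%N) ->
  (forall N, (0 < n N)%N) -> (x1 == 0) || (x2 == 0) -> 0 < e ->
  {ae P, forall t, \forall N \near \oo,
    (Num.sqrt x1 + Num.sqrt x2) ^+ 2 - e <=
    N%:R^-1 * boundary_lpp 0 0 (w t) (m N) (n N)}.
Proof.
move=> m_gt0 n_gt0 x12 e0; have [/eqP x1_0|x1_0] := boolP (x1 == 0).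
  have f_inj : injective (fun j => (1%N, j.+1)) by move=> i j [].
  have := env_lln f_inj x2_ge0 nx2; apply: filterS => t Lt.
  rewrite x1_0 sqrtr0 add0r sqr_sqrtr//.
  have lte : x2 - e < x2 by lra.
  apply: filterS (cvgr_gt _ Lt _ lte) => N /ltW /le_trans; apply.
  apply: ler_wpM2l; first by rewrite invr_ge0.
  by rewrite -(prednK (m_gt0 N)) bulk_column_le.
have f_inj : injective (fun i => (i.+1, 1%N)) by move=> i j [].
have := env_lln f_inj x1_ge0 mx1; apply: filterS => t Lt.
move: x12; rewrite (negbTE x1_0)/= => /eqP ->.
rewrite sqrtr0 addr0 sqr_sqrtr//.
have lte : x1 - e < x1 by lra.
apply: filterS (cvgr_gt _ Lt _ lte) => N /ltW /le_trans; apply.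
apply: ler_wpM2l; first by rewrite invr_ge0.
by rewrite -(prednK (n_gt0 N)) bulk_row_le.
Qed.

Lemma bulk_lower_pos (eps : R) : 0 < x1 -> 0 < x2 -> 0 < eps ->
  {ae P, forall t, \forall N \near \oo,
    (Num.sqrt x1 + Num.sqrt x2) ^+ 2 - eps <=
    N%:R^-1 * boundary_lpp 0 0 (w t) (m N) (n N)}.
Proof.
move=> x1_gt0 x2_gt0; set a := Num.sqrt x1; set b := Num.sqrt x2.
have a0 : 0 < a by rewrite sqrtr_gt0.
have b0 : 0 < b by rewrite sqrtr_gt0.
have x1E : x1 = a ^+ 2 by rewrite sqr_sqrtr.
have x2E : x2 = b ^+ 2 by rewrite sqr_sqrtr.
pose s := a + b; have s0 : 0 < s by rewrite addr_gt0.
(* The minimizer of [x1 / al + x2 / (1 - al)], with minimum [s ^+ 2]. *)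
pose al := a / s; pose be := b / s.
have al0 : 0 < al by rewrite divr_gt0.
have be0 : 0 < be by rewrite divr_gt0.
have albe : al + be = 1 by rewrite /al /be /s; field; rewrite -/s; lra.
(* The summand [1] keeps the axis contribution [e * (al^-1 + be^-1)] strictly below [eps]. *)
pose C := al^-1 + be^-1 + 1.
have C0 : 0 < C by rewrite /C !addr_gt0 ?invr_gt0.
move=> eps0; pose e := eps / C; have e0 : 0 < e by rewrite divr_gt0.
have eC : e * C = eps by rewrite /e divfK// gt_eqF.
(* The bounds on [h] under which [perturbed_density_lt] applies to the horizontal and the vertical
   axis respectively. *)
pose q1 := e * be / (s ^+ 2 * al); pose q2 := e * al / (s ^+ 2 * be).
have ss0 : 0 < s ^+ 2 by exact: exprn_gt0.
have p1 : 0 < s ^+ 2 * al by exact: mulr_gt0.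
have p2 : 0 < s ^+ 2 * be by exact: mulr_gt0.
have q1_0 : 0 < q1 by apply: divr_gt0 => //; exact: mulr_gt0.
have q2_0 : 0 < q2 by apply: divr_gt0 => //; exact: mulr_gt0.
have [h [h0 hal hbe hq1 hq2]] : exists h, [/\ 0 < h, h < al, h < be, h <= q1 & h <= q2].
  exists (Num.min (Num.min (al / 2) (be / 2)) (Num.min q1 q2)); split.
  - by rewrite !lt_min q1_0 q2_0 !divr_gt0.
  - by rewrite !gt_min; apply/orP; left; apply/orP; left; lra.
  - by rewrite !gt_min; apply/orP; left; apply/orP; right; lra.
  - by rewrite !ge_min lexx !orbT.
  - by rewrite !ge_min lexx !orbT.
have al1 : 0 < al - h by lra.
have be1 : 0 < be + h by lra.
have al2 : 0 < al + h by lra.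
have be2 : 0 < be - h by lra.
have x1E' : x1 = (al * s) ^+ 2 by rewrite /al divfK// gt_eqF.
have x2E' : x2 = (be * s) ^+ 2 by rewrite /be divfK// gt_eqF.
have gE : x1 / al + x2 / be = s ^+ 2.
  rewrite x1E' x2E' (_ : be = 1 - al); last by lra.
  by field; apply/andP; split; lra.
have lt1 : x1 / (al - h) + x2 / (be + h) - ((al - h)^-1 - al^-1) * e < s ^+ 2.
  rewrite x1E' x2E'; apply: perturbed_density_lt => //.
  by move: hq1; rewrite /q1 ler_pdivlMr// mulrC.
have lt2 : x1 / (al + h) + x2 / (be - h) - ((be - h)^-1 - be^-1) * e < s ^+ 2.
  rewrite [x1 / _ + _]addrC x1E' x2E'.
  apply: perturbed_density_lt => //; first by rewrite addrC.
  by move: hq2; rewrite /q2 ler_pdivlMr// mulrC.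
(* About [e * N] steps separate a short stay on an axis from a long one. *)
pose k := side e; have ke := side_cvg (ltW e0).
have f_inj : injective (fun i => (i.+1, 0%N)) by move=> i j [].
have g_inj : injective (fun j => (0%N, j.+1)) by move=> i j [].
have LA := env_lln f_inj (ltW e0) ke.
have LB := env_lln g_inj (ltW e0) ke.
have L0 := stationary_lln al0 be0 albe x1_ge0 x2_ge0 mx1 nx2.
have albe1 : al - h + (be + h) = 1 by rewrite -albe; ring.
have albe2 : al + h + (be - h) = 1 by rewrite -albe; ring.
have L1 := stationary_lln al1 be1 albe1 x1_ge0 x2_ge0 mx1 nx2.
have L2 := stationary_lln al2 be2 albe2 x1_ge0 x2_ge0 mx1 nx2.
apply: filterS3 L0 (filterI L1 L2) (filterI LA LB) => t t0 [t1 t2] [tA tB].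
pose A N := \sum_(1 <= i < (k N).+1) w t i 0%N.
pose B N := \sum_(1 <= j < (k N).+1) w t 0%N j.
pose G N := boundary_lpp 0 0 (w t) (m N) (n N).
pose S0 N := boundary_lpp al^-1 be^-1 (w t) (m N) (n N).
pose S1 N := boundary_lpp (al - h)^-1 (be + h)^-1 (w t) (m N) (n N).
pose S2 N := boundary_lpp (al + h)^-1 (be - h)^-1 (w t) (m N) (n N).
have {}tA : N%:R^-1 * A N @[N --> \oo] --> e.
  by under eq_fun do rewrite /A big_add1.
have {}tB : N%:R^-1 * B N @[N --> \oo] --> e.
  by under eq_fun do rewrite /B big_add1.
rewrite -/(S0 _) gE in t0.
(* For large [N] the limits rule out both long-stay alternatives of [boundary_lpp_exit] ([near1],
   [near2]), while in the short-stay one the axes cost less than [eps] ([near3]). *)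
have near1 : \forall N \near \oo,
    0 < N%:R^-1 * S0 N - (N%:R^-1 * S1 N - ((al - h)^-1 - al^-1) * (N%:R^-1 * A N)).
  apply: (cvgr_gt (s ^+ 2 - (x1 / (al - h) + x2 / (be + h) - ((al - h)^-1 - al^-1) * e))).
    by apply: cvgB => //; apply: cvgB => //; exact: cvgMr.
  by rewrite subr_gt0.
have near2 : \forall N \near \oo,
    0 < N%:R^-1 * S0 N - (N%:R^-1 * S2 N - ((be - h)^-1 - be^-1) * (N%:R^-1 * B N)).
  apply: (cvgr_gt (s ^+ 2 - (x1 / (al + h) + x2 / (be - h) - ((be - h)^-1 - be^-1) * e))).
    by apply: cvgB => //; apply: cvgB => //; exact: cvgMr.
  by rewrite subr_gt0.
have near3 : \forall N \near \oo, s ^+ 2 - eps <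
    N%:R^-1 * S0 N - (al^-1 * (N%:R^-1 * A N) + be^-1 * (N%:R^-1 * B N)).
  apply: (cvgr_gt (s ^+ 2 - (al^-1 * e + be^-1 * e))).
    by apply: cvgB => //; apply: cvgD; exact: cvgMr.
  by rewrite -eC /C; lra.
apply: filterS3 near1 near2 near3 => N D1 D2 D3.
have c0 : 0 <= (N%:R^-1 : R) by rewrite invr_ge0.
have inv_le x y : 0 < x -> x <= y -> y^-1 <= x^-1 :> R.
  by move=> xpos xy; rewrite lef_pV2 ?posrE//; exact: lt_le_trans xy.
have inv_ge0 x : 0 < x -> 0 <= x^-1 :> R by move=> /ltW; rewrite invr_ge0.
have := @boundary_lpp_exit _ al^-1 be^-1 (al - h)^-1 (be - h)^-1 (al + h)^-1
  (be + h)^-1 (w t) (k N) (m N) (n N) (A N) (B N) (w_ge0 t).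
rewrite -/(S0 N) -/(S1 N) -/(S2 N) -/(G N) => exit.
have {exit} : S0 N <= Num.max (G N + (al^-1 * A N + be^-1 * B N))
    (Num.max (S1 N - ((al - h)^-1 - al^-1) * A N)
             (S2 N - ((be - h)^-1 - be^-1) * B N)).
  have le_al : al - h <= al by rewrite gerBl ltW.
  have le_be : be - h <= be by rewrite gerBl ltW.
  exact: exit (inv_ge0 _ al0) (inv_le _ _ al1 le_al) (inv_ge0 _ be1)
    (inv_ge0 _ be0) (inv_le _ _ be2 le_be) (inv_ge0 _ al2) erefl erefl.
rewrite !le_max => /or3P[] /(ler_wpM2l c0) le.
- apply: (le_trans (ltW D3)); rewrite lerBlDr; apply: (le_trans le).
  by rewrite le_eqVlt; apply/orP; left; apply/eqP; ring.
- by move: D1; rewrite ltNge => /negP; case; move: le; lra.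
- by move: D2; rewrite ltNge => /negP; case; move: le; lra.
Qed.

End Limit.

Theorem theorem3p4 (R : realType) (d : measure_display) (T : measurableType d)
    (P : probability T R) (omega : Z2 -> {RV P >-> R})
    (omega_indep : mutually_independent omega)
    (omega_exp : forall x : Z2, exponentially_distributed 1 (omega x))
    (xi : R * R) (xi1_ge0 : 0 <= xi.1) (xi2_ge0 : 0 <= xi.2) :
  {ae P, forall t : T,
    (fun N : nat => N%:R^-1 *
        passage_time (fun x => omega x t) 0 (floor_pt (N%:R * xi.1, N%:R * xi.2)))
      @ \oo --> gpp xi}.
Proof.
pose m := side xi.1; pose n := side xi.2.
have mx1 : N%:R^-1 * (m N)%:R @[N --> \oo] --> xi.1 := side_cvg xi1_ge0.
have nx2 : N%:R^-1 * (n N)%:R @[N --> \oo] --> xi.2 := side_cvg xi2_ge0.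
pose w t := fun i j : nat => env omega (i, j) t.
pose G t N := boundary_lpp 0 0 (w t) (m N) (n N).
(* Positivity holds at all sites at once because [Z2] is countable; [pickle] enumerates it. *)
have omega_gt0 : {ae P, forall t, forall z, 0 < omega z t}.
  have one z : {ae P, forall t, 0 < omega z t}.
    have mz : measurable [set t | 0 < omega z t].
      by apply: measurable_set_lt => //; exact: measurable_funP.
    exists (~` [set t | 0 < omega z t]); split => //; first exact: measurableC.
    rewrite probability_setC// (_ : [set t | _] = omega z @^-1` `]0, +oo[%classic).
      have := omega_exp z _ (measurable_itv `]0, +oo[%R).
      rewrite exponential_prob_gt// oppr0 expR0 => P1.
      by rewrite [X in (_ - X)%E](P1 : P (omega z @^-1` _) = _) subee.
    by apply/seteqP; split => t /=; rewrite in_itv/= andbT.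
  have : {ae P, forall t, forall i : nat, forall z, unpickle i = Some z -> 0 < omega z t}.
    apply: ae_foralln => i; case: (unpickle i) => [z|]; last exact: aeW.
    by apply: filterS (one z) => t tz _ [<-].
  by apply: filterS => t tP z; apply: (tP (pickle z)); rewrite pickleK.
(* The accuracies [1 / l.+1] are countably many, so one null set serves them all. *)
have upper : {ae P, forall t, forall l : nat, \forall N \near \oo,
    N%:R^-1 * G t N <= gpp xi + l.+1%:R^-1}.
  apply: ae_foralln => l; have l0 : (0 : R) < l.+1%:R^-1 by rewrite invr_gt0.
  exact: (bulk_upper omega_indep omega_exp xi1_ge0 xi2_ge0 mx1 nx2 l0).
have lower : {ae P, forall t, forall l : nat, \forall N \near \oo,
    gpp xi - l.+1%:R^-1 <= N%:R^-1 * G t N}.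
  apply: ae_foralln => l; have l0 : (0 : R) < l.+1%:R^-1 by rewrite invr_gt0.
  have [x12|] := boolP ((xi.1 == 0) || (xi.2 == 0)).
    exact: (bulk_lower_axis omega_indep omega_exp xi1_ge0 xi2_ge0 mx1 nx2 _ _ x12 l0).
  rewrite negb_or => /andP[x1 x2].
  have x1_gt0 : 0 < xi.1 by rewrite lt0r x1.
  have x2_gt0 : 0 < xi.2 by rewrite lt0r x2.
  exact: (bulk_lower_pos omega_indep omega_exp xi1_ge0 xi2_ge0 mx1 nx2 x1_gt0 x2_gt0 l0).
apply: filterS3 omega_gt0 upper lower => t t0 up lo.
(* On positive weights the truncation in [env] has no effect, so the bulk recursion computes the
   passage time of [omega] itself. *)
have GE N : passage_time (fun x => omega x t) 0
    (floor_pt (N%:R * xi.1, N%:R * xi.2)) = G t N.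
  have natz (x : R) : 0 <= x -> Num.floor (N%:R * x) = (absz (Num.floor (N%:R * x)))%:Z.
    by move=> x0; have /gez0_abs -> : 0 <= Num.floor (N%:R * x)
      by rewrite floor_ge0 mulr_ge0.
  rewrite /floor_pt /= natz// [Num.floor (_ * xi.2)]natz// passage_time_bulk.
    congr (boundary_lpp 0 0 _ _ _); apply/funext => i; apply/funext => j.
    by rewrite /shifted_weight /w /env max_l// ltW.
  by move=> z; rewrite ltW.
under eq_fun do rewrite GE.
apply/cvgrPdist_le => e e0.
have [l le] : exists l : nat, l.+1%:R^-1 <= e.
  exists (Num.bound e^-1); rewrite -[leRHS]invrK lef_pV2 ?posrE ?invr_gt0//.
  rewrite ltW// (@lt_trans _ _ (Num.bound e^-1)%:R) ?ltr_nat//.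
  by apply: archi_boundP; rewrite invr_ge0 ltW.
apply: filterS2 (up l) (lo l) => N upN loN.
rewrite distrC ler_distl; apply/andP; split.
  by apply: le_trans loN; rewrite lerD2l lerN2.
by apply: (le_trans upN); rewrite lerD2l.
Qed.
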